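(* Let $n\ge 3$, let $F\subset\mathbb{R}^n$ be a compact convex set with $\mathbf{0}$ in its interior, and let $\xi\in\partial F$. Assume that there are $\delta>0$ and $f:\mathbb{R}^n\to\mathbb{R}$ of class $C^2$ on $\xi+\delta\mathbf{B}$ such that $F\subset\{x\in\mathbb{R}^n: f(x)\le 0\}$, $\langle \xi,\nabla f(\xi)\rangle>0$, and such that, for $x\in\xi+\delta\mathbf{B}$, we have $x\in\partial F$ if and only if $f(x)=0$. Let $i$ be the first index in $I=\{1,\dots,n\}$ with $f_{x_i}(\xi)\neq0$ and let $j\in I\setminus\{i\}$. Let $k_G(\xi)$ be the curvature (in the sense of Goldman's formula recalled in the context) at $\xi$ of the curve $\partial F\cap P(\xi,u^j(\xi))$, given near $\xi$ by the $n-1$ implicit equations $f=0$, $p_{k_1\xi}=0,\dots,p_{k_{n-2}\xi}=0$. Then $$k_G(\xi)=2\,\hat\varkappa_F(\xi,u^j(\xi)).$$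
   Context: $\langle\cdot,\cdot\rangle$ and $\|\cdot\|$ are the usual inner product and norm of $\mathbb{R}^n$, $\mathbf{B}$ is the open unit ball, and $f_{x_k}=\partial f/\partial x_k$. Directional curvature. All points $\eta$ are taken close enough to $\xi$ that $\langle\eta,\nabla f(\eta)\rangle>0$ and $f_{x_i}(\eta)\ne0$. For $\eta\in\partial F$ near $\xi$: $\eta^*:=\frac{1}{\langle\eta,\nabla f(\eta)\rangle}\nabla f(\eta)$; $u^j(\eta)$ is the vector with $1$ in the $j$th coordinate, $-\frac{f_{x_j}(\eta)}{f_{x_i}(\eta)}$ in the $i$th coordinate and $0$ in the others; $P(\eta,u):=\eta+\operatorname{span}\{\nabla f(\eta),u\}$ for $u\ne\mathbf0$ orthogonal to $\nabla f(\eta)$; $\widehat{\mathfrak C}_F(r,\eta,u):=\inf\{\langle\eta-y,\eta^*\rangle: y\in F\cap P(\eta,u),\ \|\eta-y\|\ge r\}$ for $r>0$ (with $\inf\emptyset=+\infty$). Then $$\hat\varkappa_F(\xi,u^j(\xi)):=\frac1{\|\xi^*\|}\liminf_{(r,\eta)\to(0^+,\xi),\ \eta\in\partial F}\frac{\widehat{\mathfrak C}_F(r,\eta,u^j(\eta))}{r^2}.$$ The functions $p_{k\xi}$. For $k\in I\setminus\{i,j\}$ and $l\in\{i,j\}$ put $a_{kl}(\xi):=-\frac{f_{x_l}(\xi)f_{x_k}(\xi)}{f_{x_i}^2(\xi)+f_{x_j}^2(\xi)}$ and $$p_{k\xi}(\eta):=\eta_k-\xi_k+a_{ki}(\xi)(\eta_i-\xi_i)+a_{kj}(\xi)(\eta_j-\xi_j),\quad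 \eta\in\mathbb{R}^n.$$ Let $k_1<\dots<k_{n-2}$ be the elements of $I\setminus\{i,j\}$. One has $P(\xi,u^j(\xi))=\bigcap_{k\in I\setminus\{i,j\}}\{\eta: p_{k\xi}(\eta)=0\}$. Goldman's curvature. For $n-1$ implicit hypersurfaces $F_1=0,\dots,F_{n-1}=0$ in $\mathbb{R}^n$, let $\operatorname{Tan}(F_1,\dots,F_{n-1})(x)$ be the row vector obtained by formally expanding along the first row the determinant of the $n\times n$ matrix with rows $(e_1,\dots,e_n)$, $\nabla F_1(x),\dots,\nabla F_{n-1}(x)$, where $(e_1,\dots,e_n)$ is the canonical basis of $\mathbb{R}^n$. Let $\nabla(\operatorname{Tan})(x)$ be the $n\times n$ matrix whose $s$th column is the gradient at $x$ of the $s$th component of $\operatorname{Tan}$, and let $*$ be matrix product. For $u,v\in\mathbb{R}^n$, $\|u\wedge v\|^2:=\sum_{s<t}(u_sv_t-u_tv_s)^2$. The curvature at $\xi$ of the intersection curve is $$k_G(\xi):=\frac{\big\|\big(\operatorname{Tan}(\xi)*\nabla(\operatorname{Tan})(\xi)\big)\wedge\operatorname{Tan}(\xi)\big\|}{\|\operatorname{Tan}(\xi)\|^3},\qquad \operatorname{Tan}=\operatorname{Tan}(F_1,\dots,F_{n-1}),$$ here applied with $F_1=f$, $F_2=p_{k_1\xi},\dots,F_{n-1}=p_{k_{n-2}\xi}$. *)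

(* Defs.v *)
From HB Require Import structures.
From mathcomp Require Import all_boot all_order all_algebra.
From mathcomp Require Import all_classical all_reals all_analysis.
Set Implicit Arguments.
Unset Strict Implicit.
Unset Printing Implicit Defensive.
Import Order.TTheory GRing.Theory Num.Theory.
Import numFieldNormedType.Exports.
Local Open Scope classical_set_scope.
Local Open Scope ring_scope.

(* Points of R^n are row vectors.  The library's norm [`|x|] on ['rV[R]_n] is
   the sup norm; it is used here only through the topology it induces, and
   every metric notion goes through [enorm]. *)

Section Euclidean.
Context {R : realType} {n : nat}.
Implicit Types (u v x eta : 'rV[R]_n) (f : 'rV[R]_n -> R).

Definition dotp u v : R := \sum_(k < n) u 0 k * v 0 k.

Definition enorm u : R := Num.sqrt (dotp u u).

Definition eball x (delta : R) : set 'rV[R]_n :=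
  [set y | enorm (y - x) < delta].

Definition boundary (A : set 'rV[R]_n) : set 'rV[R]_n :=
  closure A `\` interior A.

Definition partial (k : 'I_n) f : 'rV[R]_n -> R :=
  fun x => 'D_(delta_mx 0 k : 'rV[R]_n) f x.

Definition grad f x : 'rV[R]_n := \row_k partial k f x.

(* Meant for open [U]: all partial derivatives of order at most [m] exist and
   are continuous at each point of [U]. *)
Fixpoint class_C (m : nat) f (U : set 'rV[R]_n) : Prop :=
  {in U, continuous f} /\
  if m is m'.+1 then
    forall k : 'I_n,
      {in U, forall x, derivable f x (delta_mx 0 k : 'rV[R]_n)} /\
      class_C m' (partial k f) U
  else True.

End Euclidean.

Section DirectionalCurvature.
Context {R : realType} {n : nat}.
Variables (F : set 'rV[R]_n) (f : 'rV[R]_n -> R).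
Implicit Types (eta u : 'rV[R]_n) (i j : 'I_n).

Definition star eta : 'rV[R]_n := (dotp eta (grad f eta))^-1 *: grad f eta.

Definition udir i j eta : 'rV[R]_n :=
  \row_k (if k == j then 1
          else if k == i then - (partial j f eta / partial i f eta)
          else 0).

Definition plane eta u : set 'rV[R]_n :=
  [set y | y - eta \in <<[:: grad f eta; u]>>%VS].

Definition Chat (r : R) eta u : \bar R :=
  ereal_inf [set (dotp (eta - y) (star eta))%:E |
              y in F `&` plane eta u `&` [set y | r <= enorm (eta - y)]].

Definition dir_curvature i j (xi : 'rV[R]_n) : \bar R :=
  ((enorm (star xi))^-1%:E *
   limf_einf
     (fun p : R * 'rV[R]_n => Chat p.1 p.2 (udir i j p.2) * (p.1 ^- 2)%:E)
     (filter_prod 0^'+ (within (boundary F) (nbhs xi))))%E.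

End DirectionalCurvature.

Section GoldmanCurvature.
Context {R : realType} {n : nat}.
Implicit Types (x u v : 'rV[R]_n) (Fs : 'I_n.-1 -> 'rV[R]_n -> R).

(* The component of index [s] is the coefficient of [e_s] in the expansion
   along the first row of the determinant with rows [(e_1, ..., e_n)],
   [grad F_1 x], ..., [grad F_(n-1) x]. *)
Definition Tan Fs x : 'rV[R]_n :=
  \row_s ((-1) ^+ s *
          \det (col' s (\matrix_(a < n.-1) grad (Fs a) x))).

Definition gradTan Fs x : 'M[R]_n :=
  \matrix_(t, s) grad (fun y => Tan Fs y 0 s) x 0 t.

Definition wedge_norm u v : R :=
  Num.sqrt (\sum_(s < n) \sum_(t < n | (s < t)%N)
              (u 0 s * v 0 t - u 0 t * v 0 s) ^+ 2).

Definition goldman_curvature Fs x : R :=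
  wedge_norm (Tan Fs x *m gradTan Fs x) (Tan Fs x) / enorm (Tan Fs x) ^+ 3.

End GoldmanCurvature.

Section SectionCurve.
Context {R : realType} {n : nat}.
Variables (f : 'rV[R]_n -> R) (i j : 'I_n) (xi : 'rV[R]_n).

Definition acoef (k l : 'I_n) : R :=
  - (partial l f xi * partial k f xi
     / (partial i f xi ^+ 2 + partial j f xi ^+ 2)).

Definition pfun (k : 'I_n) (eta : 'rV[R]_n) : R :=
  eta 0 k - xi 0 k + acoef k i * (eta 0 i - xi 0 i)
                   + acoef k j * (eta 0 j - xi 0 j).

(* [enum] lists the indices other than [i] and [j] in increasing order; for
   [i != j] the list below has exactly [n.-1] entries, so the default value of
   [nth] is never used. *)
Definition curve_eqs (a : 'I_n.-1) : 'rV[R]_n -> R :=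
  nth f (f :: [seq pfun k | k <- enum (~: [set i; j])]) a.

End SectionCurve.

(* Main.v *)
Require Import Defs.
From HB Require Import structures.
From mathcomp Require Import all_boot all_order all_algebra perm.
From mathcomp Require Import all_classical all_reals all_analysis.
From mathcomp Require Import ring lra.
Import Order.TTheory GRing.Theory Num.Theory.
Import numFieldNormedType.Exports.
Set Implicit Arguments.
Unset Strict Implicit.
Unset Printing Implicit Defensive.
Local Open Scope classical_set_scope.
Local Open Scope ring_scope.

(** Write [N] for the gradient of [f], [u] for the vector field [udir f i j],
    which is orthogonal to [N], and [q] for the quadratic form of the Hessian
    of [f] at [xi]. Both sides of the theorem are equal to
    [q(u) / (|u|^2 |N|)] at [xi]: this is the normal curvature of the level set
    [f = 0] in the direction [u], and the section of the boundary by a plane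
    that contains the normal has exactly this curvature.

    Goldman's formula. The functions [p_k] are affine and their gradients are
    orthogonal to [N xi] and [u xi], which complete them to a basis. The
    generalized cross product of a vector [v] with these gradients therefore
    lies in the plane of [N xi] and [u xi], and being alternating it is
    [c (<v, N> u - <v, u> N)] with a constant [c != 0] ([cross_in_plane]). With
    [v] the gradient of [f] at a variable point this is the whole tangent field
    [Tan]; differentiating it once along itself gives a closed formula
    ([goldman_curvatureE]), in which [q(u)] appears in absolute value.

    Directional curvature. The depth [<eta - y, eta*>] is the component of
    [eta - y] along the normal at [eta]. On the section of the boundary at
    [eta], Taylor's formula says that a point at distance [r] from [eta] has
    depth about [r^2 q(u) / (2 |u|^2 <eta, N>)]; so the quotient of the modulus
    [Chat] by [r^2] has a genuine limit [kappa], and the lower limit is this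
    limit ([dir_curvatureE]). Three points need care.
    - A point of [F] at distance more than [r] is at least as deep as the point
      at distance exactly [r] on the segment joining it to [eta], which lies in
      [F] by convexity ([depth_lower_bound]).
    - The infimum is almost attained: a point slightly below the osculating
      parabola has [f < 0], and near [xi] such points belong to [F]
      ([near_sublevel_mem]). The hypotheses give [f <= 0] on [F]; that
      [f < 0] conversely implies membership near [xi] follows from [0] being
      interior to [F] and [f] increasing along rays near [xi].
    - The estimates hold with [eta] varying, so Taylor's formula is needed with
      a remainder that is uniform in the base point ([taylor2_uniform]).
    Depths are nonnegative, hence [kappa >= 0] and [q(u) >= 0], which removes
    the absolute value in Goldman's formula.

    Smoothness is given by continuity of partial derivatives, so the chain rule
    along lines ([is_derive_partial]) and Taylor's formula ([taylor2]) are first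
    derived from that. *)

(** * The Euclidean structure of row vectors *)

Section EuclideanAlgebra.
Context {R : realType} {n : nat}.
Implicit Types (u v w x y : 'rV[R]_n) (a : R).

Lemma dotpC u v : dotp u v = dotp v u.
Proof. by apply: eq_bigr => k _; rewrite mulrC. Qed.

Lemma dotpDl u v w : dotp (u + v) w = dotp u w + dotp v w.
Proof. by rewrite -big_split; apply: eq_bigr => k _; rewrite mxE mulrDl. Qed.

Lemma dotpZl a u v : dotp (a *: u) v = a * dotp u v.
Proof. by rewrite mulr_sumr; apply: eq_bigr => k _; rewrite mxE mulrA. Qed.

Lemma dotpNl u v : dotp (- u) v = - dotp u v.
Proof. by rewrite -scaleN1r dotpZl mulN1r. Qed.

Lemma dotpBl u v w : dotp (u - v) w = dotp u w - dotp v w.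
Proof. by rewrite dotpDl dotpNl. Qed.

Lemma dotpDr u v w : dotp u (v + w) = dotp u v + dotp u w.
Proof. by rewrite dotpC dotpDl !(dotpC u). Qed.

Lemma dotpZr a u v : dotp u (a *: v) = a * dotp u v.
Proof. by rewrite dotpC dotpZl dotpC. Qed.

Lemma dotpE u v : dotp u v = (u *m v^T) 0 0.
Proof. by rewrite mxE; apply: eq_bigr => k _; rewrite mxE. Qed.

Lemma dotp_delta u k : dotp u (delta_mx 0 k) = u 0 k.
Proof.
rewrite /dotp (bigD1 k) //= big1 => [|l lk]; rewrite !mxE ?eqxx ?mulr1 ?addr0 //.
by rewrite (negbTE lk) mulr0.
Qed.

Lemma dotpp_ge0 u : 0 <= dotp u u.
Proof. by apply: sumr_ge0 => k _; rewrite -expr2 sqr_ge0. Qed.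

Lemma coord_sqr_le u k : u 0 k ^+ 2 <= dotp u u.
Proof.
rewrite /dotp (bigD1 k) //= expr2 lerDl.
by apply: sumr_ge0 => l _; rewrite -expr2 sqr_ge0.
Qed.

Lemma dotpp_gt0 u k : u 0 k != 0 -> 0 < dotp u u.
Proof. by move=> uk; apply: lt_le_trans (coord_sqr_le u k); rewrite exprn_even_gt0. Qed.

Lemma enorm_ge0 u : 0 <= enorm u.
Proof. exact: sqrtr_ge0. Qed.

Lemma sqr_enorm u : enorm u ^+ 2 = dotp u u.
Proof. by rewrite sqr_sqrtr // dotpp_ge0. Qed.

Lemma enormZ a u : enorm (a *: u) = `|a| * enorm u.
Proof.
by rewrite /enorm dotpZl dotpZr mulrA -expr2 sqrtrM ?sqr_ge0 // sqrtr_sqr.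
Qed.

Lemma enormN u : enorm (- u) = enorm u.
Proof. by rewrite -scaleN1r enormZ normrN1 mul1r. Qed.

Lemma enorm_gt0 u : (0 < enorm u) = (0 < dotp u u).
Proof. by rewrite sqrtr_gt0. Qed.

Lemma coord_le_enorm u k : `|u 0 k| <= enorm u.
Proof. by rewrite -sqrtr_sqr ler_wsqrtr // coord_sqr_le. Qed.

Lemma norm_le_enorm u : `|u| <= enorm u.
Proof.
rewrite /Num.Def.normr /= mx_normrE; apply: bigmax_le; first exact: enorm_ge0.
by move=> [s k] _ /=; rewrite ord1 coord_le_enorm.
Qed.

Lemma coord_le_norm u k : `|u 0 k| <= `|u|.
Proof.
rewrite [leRHS]/Num.Def.normr /= mx_normrE.
exact: (le_bigmax _ (fun ij => `|u ij.1 ij.2|) (0, k)).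
Qed.

(** Lagrange's identity: summed over all pairs [(s, t)] the squares give
    twice the sum over [s < t], by antisymmetry. *)
Lemma wedge_normE u v :
  wedge_norm u v = Num.sqrt (dotp u u * dotp v v - dotp u v ^+ 2).
Proof.
congr Num.sqrt.
pose G (s t : 'I_n) := (u 0 s * v 0 t - u 0 t * v 0 s) ^+ 2.
have GC s t : G s t = G t s by rewrite /G; ring.
have Gss s : G s s = 0 by rewrite /G subrr expr0n.
have half : \sum_(s < n) \sum_(t < n | (s < t)%N) G s t
    = \sum_(s < n) \sum_(t < n | (t < s)%N) G s t.
  rewrite (exchange_big_dep predT) //=; apply: eq_bigr => s _.
  by apply: eq_bigr => t _; rewrite GC.
have all2 : \sum_s \sum_t G s t
    = (\sum_(s < n) \sum_(t < n | (s < t)%N) G s t) *+ 2.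
  rewrite mulr2n {2}half -big_split; apply: eq_bigr => s _ /=.
  rewrite (bigD1 s) //= Gss add0r (bigID (fun t : 'I_n => (s < t)%N)) /=.
  congr (_ + _); apply: eq_bigl => t; rewrite -val_eqE /=; by case: ltngtP.
apply: (@mulIf _ 2); first by rewrite pnatr_eq0.
rewrite mulr_natr -all2 mulrBl /dotp expr2 !big_distrlr /=.
have E : \sum_s \sum_t (u 0 s * u 0 s) * (v 0 t * v 0 t)
       = \sum_s \sum_t (u 0 t * u 0 t) * (v 0 s * v 0 s) :> R.
  exact: exchange_big.
rewrite !mulr_natr !mulr2n {2}E -!big_split -sumrB /=.
apply: eq_bigr => s _; rewrite -!big_split -sumrB /=; apply: eq_bigr => t _.
by rewrite /G; ring.
Qed.

End EuclideanAlgebra.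

(** * Limits of row vectors *)

Section RowVectorLimits.
Context {R : realType} {n : nat}.

Lemma cvg_row (T : Type) (F : set_system T) {FF : Filter F}
    (A : T -> 'rV[R]_n) (L : 'rV[R]_n) :
  (forall k, (fun t => A t 0 k) @ F --> L 0 k) -> A @ F --> L.
Proof.
move=> AL; apply/cvgrPdist_le => e e0; near=> t.
rewrite /Num.Def.normr /= mx_normrE (bigmax_le _ (ltW e0)) //= => ij _.
rewrite !mxE ord1; move: ij; near: t; apply: filter_forall => /= ij.
exact: ((cvgrPdist_le _ _).1 (AL ij.2)).
Unshelve. all: by end_near. Qed.

Lemma cvg_coord (T : Type) (F : set_system T) {FF : Filter F}
    (A : T -> 'rV[R]_n) (L : 'rV[R]_n) k :
  A @ F --> L -> (fun t => A t 0 k) @ F --> L 0 k.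
Proof.
move=> AL; apply: (@cvg_comp _ _ _ A (fun M : 'rV[R]_n => M 0 k) _ _ _ AL).
exact: coord_continuous.
Qed.

Lemma cvg_dotp (T : Type) (F : set_system T) {FF : Filter F}
    (A B : T -> 'rV[R]_n) (L M : 'rV[R]_n) :
  A @ F --> L -> B @ F --> M -> (fun t => dotp (A t) (B t)) @ F --> dotp L M.
Proof.
move=> AL BM; apply: cvg_big => [|k _]; first exact: add_continuous.
by apply: cvgM; exact: cvg_coord.
Qed.

Lemma cvg_mulmx_row (T : Type) (F : set_system T) {FF : Filter F}
    (A : T -> 'rV[R]_n) (L : 'rV[R]_n) (H : 'M[R]_n) :
  A @ F --> L -> (fun t => A t *m H) @ F --> L *m H.
Proof.
move=> AL; apply: cvg_row => k; rewrite mxE.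
under eq_fun do rewrite mxE.
apply: cvg_big => [|l _]; first exact: add_continuous.
by apply: cvgMl; exact: cvg_coord.
Qed.

Lemma cvg_enorm (T : Type) (F : set_system T) {FF : Filter F}
    (A : T -> 'rV[R]_n) (L : 'rV[R]_n) :
  A @ F --> L -> (fun t => enorm (A t)) @ F --> enorm L.
Proof.
move=> AL; apply: (@cvg_comp _ _ _ (fun t => dotp (A t) (A t)) Num.sqrt).
  exact: (cvg_dotp AL AL).
exact: sqrt_continuous.
Qed.

Lemma open_eball (x : 'rV[R]_n) d : open (eball x d).
Proof.
rewrite (_ : eball x d = (fun y => enorm (y - x)) @^-1` [set r | r < d]) //.
apply: open_comp; last exact: open_lt.
move=> y _; apply: (@cvg_enorm _ (nbhs y) _ (fun y => y - x) (y - x)).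
exact: (cvgB cvg_id (cvg_cst _)).
Qed.

End RowVectorLimits.

(** * Functions with continuous partial derivatives *)

Section PartialDerivatives.
Context {R : realType} {n : nat}.
Implicit Types (f : 'rV[R]_n -> R) (x y v w : 'rV[R]_n) (U : set 'rV[R]_n).

Lemma is_derive_line f x v t d :
  is_derive (x + t *: v) v f d -> is_derive t 1 (fun s : R => f (x + s *: v)) d.
Proof.
move=> [dr dv].
have E : (fun h : R =>
      h^-1 *: (f (x + (h%:A + t) *: v) - f (x + t *: v)))
    = (fun h => h^-1 *: ((f \o shift (x + t *: v)) (h *: v) - f (x + t *: v))).
  apply/funext => h /=; congr (_ *: (f _ - _)).
  by rewrite [_%:A]mulr1 scalerDl addrCA.
by split; rewrite /derivable /derive /= E.
Qed.

(** The mean value theorem on the segment from [y] to [y + c *: e], whatever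
    the sign of [c]. *)
Lemma mean_value_line f y (e : 'rV[R]_n) (c : R) :
  (forall s : R, `|s| <= `|c| -> derivable f (y + s *: e) e) ->
  exists2 s, `|s| <= `|c| & f (y + c *: e) - f y = c * 'D_e f (y + s *: e).
Proof.
move=> df.
pose g (s : R) := f (y + s *: e).
have dg (s : R) : `|s| <= `|c| -> is_derive s 1 g ('D_e f (y + s *: e)).
  by move=> /df /derivableP; exact: is_derive_line.
have g0 : g 0 = f y by rewrite /g scale0r addr0.
have mvt (a b : R) : a <= b ->
    (forall s : R, s \in `[a, b] -> `|s| <= `|c|) ->
    exists2 s, `|s| <= `|c| & g b - g a = 'D_e f (y + s *: e) * (b - a).
  move=> ab sub.
  have [||s sab E] :=
    @MVT_segment _ g (fun s => 'D_e f (y + s *: e)) _ _ ab.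
  - by move=> s sab; apply: dg; apply: sub; exact: subset_itv_oo_cc sab.
  - by apply: derivable_within_continuous => s /sub /dg [].
  - by exists s => //; exact: sub.
have [c0|c0] := leP 0 c.
- have [|s sc E] := mvt _ _ c0.
    by move=> s; rewrite in_itv /= => /andP[s0 sc]; rewrite !ger0_norm // (le_trans s0).
  by exists s => //; rewrite -g0 -/(g c) E subr0 mulrC.
- have [|s sc E] := mvt _ _ (ltW c0).
    by move=> s; rewrite in_itv /= => /andP[cs s0]; rewrite !ler0_norm ?lerN2 // ltW.
  by exists s => //; rewrite -g0 -/(g c) -opprB E sub0r mulrN opprK mulrC.
Qed.

(** Moving from [x] to [x + w] one coordinate at a time writes the increment
    of [f] with partial derivatives only. *)
Lemma coordinatewise_mean_value f x w :
  (forall k y, `|y - x| <= `|w| -> derivable f y (delta_mx 0 k)) ->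
  exists2 z : 'I_n -> 'rV[R]_n, (forall k, `|z k - x| <= `|w|) &
    f (x + w) - f x = \sum_k w 0 k * partial k f (z k).
Proof.
move=> df.
(* [tr m] keeps the first [m] coordinates of [w] *)
pose tr (m : nat) : 'rV[R]_n := \row_j (if (j < m)%N then w 0 j else 0).
have trS (k : 'I_n) : tr k.+1 = tr k + w 0 k *: delta_mx 0 k.
  apply/rowP => j; rewrite !mxE eqxx /= ltnS leq_eqVlt val_eqE.
  by case: eqVneq => [->|_]; rewrite ?ltnn ?mulr1 ?add0r ?mulr0 ?addr0.
have tr_le (k : 'I_n) (s : R) : `|s| <= `|w 0 k| -> `|tr k + s *: delta_mx 0 k| <= `|w|.
  move=> sk; rewrite [leLHS]/Num.Def.normr /= mx_normrE.
  apply: bigmax_le => // -[a j] _ /=; rewrite !mxE ord1 eqxx /=.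
  case: eqVneq => [->|_]; rewrite ?ltnn ?mulr1 ?add0r ?mulr0 ?addr0.
    by apply: le_trans sk _; exact: coord_le_norm.
  by case: ifP; rewrite ?normr0 // coord_le_norm.
have step (k : 'I_n) : exists z, `|z - x| <= `|w| /\
    f (x + tr k.+1) - f (x + tr k) = w 0 k * partial k f z.
  have [|s sk E] := @mean_value_line f (x + tr k) (delta_mx 0 k) (w 0 k).
    by move=> s sk; apply: df; rewrite -[x + _ + _]addrA addrAC subrr add0r tr_le.
  exists (x + tr k + s *: delta_mx 0 k); rewrite trS addrA E; split=> //.
  by rewrite -[x + _ + _]addrA addrAC subrr add0r tr_le.
have [z zP] := fin_all_exists step.
exists z => [k|]; first by have [] := zP k.
have -> : w = tr n by apply/rowP => j; rewrite mxE ltn_ord.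
have {2}-> : x = x + tr 0%N by apply/rowP => j; rewrite !mxE addr0.
rewrite -(telescope_sumr (fun m => f (x + tr m)) (leq0n n)) big_mkord.
by apply: eq_bigr => k _; have [_ ->] := zP k; rewrite mxE ltn_ord.
Qed.

(** The chain rule along a line. Continuity of the partial derivatives at [x]
    makes their values at the intermediate points of
    [coordinatewise_mean_value] close to those at [x]. *)
Lemma is_derive_partial f x v :
  (forall k, \forall y \near x, derivable f y (delta_mx 0 k)) ->
  (forall k, {for x, continuous (partial k f)}) ->
  is_derive x v f (dotp v (grad f x)).
Proof.
move=> df cf.
suff cv : (fun h : R => h^-1 *: ((f \o shift x) (h *: v) - f x)) @ 0^'
    --> dotp v (grad f x).
  by split; [apply/cvg_ex; eexists; exact: cv|exact: cvg_lim cv].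
apply/cvgrPdist_le => e e0.
(* the [+ 1] only keeps [M] positive when [v = 0] *)
pose M := \sum_k `|v 0 k| + 1.
have M0 : 0 < M by rewrite ltr_pwDr // sumr_ge0.
have eM : 0 < e / M by rewrite divr_gt0.
have near_df : \forall y \near x, forall k : 'I_n, derivable f y (delta_mx 0 k).
  exact: (filter_forall _ df).
have near_cf : \forall y \near x, forall k : 'I_n,
    `|partial k f x - partial k f y| <= e / M.
  by apply: (@filter_forall _ _
    (fun k y => `|partial k f x - partial k f y| <= e / M) (nbhs x)) => k;
    exact: ((cvgrPdist_le _ _).1 (cf k) _ eM).
have [d /= d0 dP] := (nbhs_ballP _ _).1 (filterI near_df near_cf).
near=> h.
have h0 : h != 0 by near: h; exact: nbhs_dnbhs_neq.
have hv : `|h *: v| < d.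
  near: h; apply: cvgr0_norm_lt => //.
  rewrite -(scale0r v); apply: cvgZl.
  exact: nbhs_dnbhs.
have close y : `|y - x| <= `|h *: v| ->
    (forall k, derivable f y (delta_mx 0 k)) /\
    (forall k, `|partial k f x - partial k f y| <= e / M).
  move=> yx; apply: dP; rewrite -ball_normE /= distrC; exact: le_lt_trans yx hv.
have [|z zx E] := @coordinatewise_mean_value f x (h *: v).
  by move=> k y /close[].
rewrite /= [_ + x]addrC E /dotp.
have -> : h^-1 *: (\sum_k (h *: v) 0 k * partial k f (z k))
    = \sum_k v 0 k * partial k f (z k).
  rewrite scaler_sumr; apply: eq_bigr => k _.
  by rewrite mxE -[_ *: _]/(_ * _) !mulrA mulVf // mul1r.
rewrite -sumrB; apply: le_trans (ler_norm_sum _ _ _) _.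
apply: (@le_trans _ _ (\sum_k `|v 0 k| * (e / M))).
  apply: ler_sum => k _; rewrite mxE -mulrBr normrM ler_wpM2l //.
  by have [_] := close _ (zx k); apply.
rewrite -mulr_suml mulrCA ger_pMr // ler_pdivrMr // mul1r /M.
by rewrite lerDl ler01.
Unshelve. all: by end_near. Qed.

Lemma class_C_continuous m f U x :
  class_C m f U -> U x -> {for x, continuous f}.
Proof. by case: m => [|m] [cf _] Ux; apply: cf; rewrite inE. Qed.

Lemma class_C_partial m f U k : class_C m.+1 f U -> class_C m (partial k f) U.
Proof. by move=> [_ /(_ k)[]]. Qed.

Lemma class_C_derivable m f U k x :
  class_C m.+1 f U -> U x -> derivable f x (delta_mx 0 k).
Proof. by move=> [_ /(_ k)[df _]] Ux; apply: df; rewrite inE. Qed.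

Lemma class_C_is_derive m f U x v : open U -> class_C m.+1 f U -> U x ->
  is_derive x v f (dotp v (grad f x)).
Proof.
move=> oU cf Ux; apply: is_derive_partial => k.
  apply: filterS (open_nbhs_nbhs (conj oU Ux)) => y.
  exact: class_C_derivable cf.
exact: class_C_continuous (class_C_partial k cf) Ux.
Qed.

Definition hess f x : 'M[R]_n := \matrix_(k, l) partial l (partial k f) x.

Definition qform (H : 'M[R]_n) v : R := dotp (v *m H) v.

Lemma is_derive_dotp_grad f U x v w : open U -> class_C 2 f U -> U x ->
  is_derive x v (fun y => dotp w (grad f y)) (dotp (w *m hess f x) v).
Proof.
move=> oU cf Ux.
have -> : (fun y => dotp w (grad f y)) = \sum_k (w 0 k *: partial k f).
  by apply/funext => y; rewrite fct_sumE; apply: eq_bigr => k _; rewrite mxE.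
apply: is_derive_eq.
  apply: is_derive_sum => k; apply: is_deriveZ.
  exact: (class_C_is_derive v oU (class_C_partial k cf)).
rewrite /= /dotp.
under eq_bigr => k _ do rewrite -[_ *: _]/(_ * _) mulr_sumr.
rewrite exchange_big; apply: eq_bigr => l _ /=; rewrite mxE mulr_suml.
by apply: eq_bigr => k _; rewrite !mxE; ring.
Qed.

(** Taylor's formula on the segment from [x] to [x + v]: Rolle's theorem
    applies to [g t + (1 - t) g' t + (1 - t)^2 c], where [g t = f (x + t v)]
    and [c] makes the values at [0] and [1] agree. *)
Lemma taylor2 f U x v : open U -> class_C 2 f U ->
  (forall t, t \in `[0, 1] -> U (x + t *: v)) ->
  exists2 t, t \in `[0, 1] &
    f (x + v) = f x + dotp v (grad f x) + qform (hess f (x + t *: v)) v / 2.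
Proof.
move=> oU cf seg.
pose g (s : R) := f (x + s *: v).
pose g1 (s : R) := dotp v (grad f (x + s *: v)).
pose g2 (s : R) := qform (hess f (x + s *: v)) v.
have dg (s : R) : s \in `[0, 1] -> is_derive s 1 g (g1 s).
  move=> s01; apply: is_derive_line.
  by apply: (class_C_is_derive _ oU cf); exact: seg.
have dg1 (s : R) : s \in `[0, 1] -> is_derive s 1 g1 (g2 s).
  move=> s01; apply: (is_derive_line (f := fun y => dotp v (grad f y))).
  by apply: (is_derive_dotp_grad _ _ oU cf); exact: seg.
pose c := g 1 - g 0 - g1 0.
pose phi : R -> R := g + (cst 1 - id) * g1 + c *: (cst 1 - id) ^+ 2.
have dphi (s : R) : s \in `[0, 1] ->
    is_derive s 1 phi ((1 - s) * (g2 s - 2 * c)).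
  move=> s01; have [d0 d1] := (dg s s01, dg1 s s01).
  have d1s := is_deriveB (is_derive_cst (1 : R) s 1) (is_derive_id s (1 : R)).
  have dA := is_deriveD d0 (is_deriveM d1s d1).
  apply: (is_derive_eq (is_deriveD dA (is_deriveZ c (is_deriveX 2 d1s)))).
  have -> : (cst 1 - id) s = 1 - s by [].
  by rewrite /= expr1 -![_ *: _]/(_ * _); ring.
have [|||t t01 dt] := @Rolle _ phi 0 1 ltr01.
- by move=> s /subset_itv_oo_cc /dphi [].
- by apply: derivable_within_continuous => s /dphi [].
- have phiE s : phi s = g s + (1 - s) * g1 s + c * (1 - s) ^+ 2 by [].
  by rewrite !phiE /c; ring.
have t01' := subset_itv_oo_cc t01.
exists t => //.
have [_ E] := dphi t t01'; have [_ E'] := dt.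
have : (1 - t) * (g2 t - 2 * c) = 0 by rewrite -E -E'.
move/eqP; rewrite mulf_eq0 subr_eq0 gt_eqF /=; last first.
  by move: t01; rewrite in_itv => /andP[].
move=> /eqP; rewrite -/(g2 t).
have <- : g 1 = f (x + v) by rewrite /g scale1r.
have <- : g 0 = f x by rewrite /g scale0r addr0.
have <- : g1 0 = dotp v (grad f x) by rewrite /g1 scale0r addr0.
by rewrite /c => H; lra.
Qed.

End PartialDerivatives.

(** * Generalized cross products *)

Section CrossProduct.
Context {R : realType}.

Definition cross m (M : 'M[R]_(m, m.+1)) : 'rV[R]_m.+1 :=
  \row_s ((-1) ^+ s * \det (col' s M)).

Lemma dotp_cross m (v : 'rV[R]_m.+1) (M : 'M[R]_(m, m.+1)) :
  dotp v (cross M) = \det (col_mx v M : 'M[R]_m.+1).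
Proof.
rewrite (expand_det_row _ 0); apply: eq_bigr => s _; rewrite mxE /cofactor add0n.
have -> : row' 0 (col' s (col_mx v M : 'M[R]_m.+1)) = col' s M.
  apply/matrixP => a b; rewrite [RHS]mxE 2![LHS]mxE.
  rewrite (_ : lift (0 : 'I_m.+1) a = rshift 1 a); last exact: val_inj.
  by rewrite (@col_mxEd _ 1).
congr (_ * _).
rewrite (_ : (0 : 'I_m.+1) = lshift m (0 : 'I_1)); last exact: val_inj.
by rewrite (@col_mxEu _ 1).
Qed.

Lemma dotp_row m n (v : 'rV[R]_n) (M : 'M[R]_(m, n)) a :
  dotp v (row a M) = (M *m v^T) a 0.
Proof. by rewrite dotpC dotpE -row_mul mxE. Qed.

Section Plane.
Variables (m : nat) (Q : 'M[R]_(m, m.+2)).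
Implicit Types u v w : 'rV[R]_m.+2.

Let crossQ w : 'rV[R]_m.+2 := cross (col_mx w Q : 'M[R]_(m.+1, m.+2)).

Lemma dotp_crossQ v w :
  dotp v (crossQ w) = \det (col_mx v (col_mx w Q : 'M[R]_(m.+1, m.+2)) : 'M[R]_m.+2).
Proof. exact: dotp_cross. Qed.

(** The two determinants differ by an exchange of their first two rows. *)
Lemma dotp_crossQC v w : dotp v (crossQ w) = - dotp w (crossQ v).
Proof.
rewrite !dotp_crossQ.
have -> : (col_mx w (col_mx v Q : 'M[R]_(m.+1, m.+2)) : 'M[R]_m.+2)
    = xrow 0 1 (col_mx v (col_mx w Q : 'M[R]_(m.+1, m.+2))).
  apply/matrixP => a b; rewrite [RHS]mxE.
  have e0 : (0 : 'I_m.+2) = lshift m.+1 (0 : 'I_1) by exact: val_inj.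
  have e1 : (1 : 'I_m.+2) = rshift 1 (lshift m (0 : 'I_1)) by exact: val_inj.
  case: tpermP => [->|->|/eqP a0 /eqP a1].
  - by rewrite e1 e0 (@col_mxEu _ 1) (@col_mxEd _ 1) (@col_mxEu _ 1).
  - by rewrite e1 e0 (@col_mxEu _ 1) (@col_mxEd _ 1) (@col_mxEu _ 1).
  - case: (@split_ordP 1 m.+1 a) a0 a1 => [a' ->|a' ->].
      by rewrite ord1 -e0 eqxx.
    case: (@split_ordP 1 m a') => [a'' ->|a'' ->].
      by rewrite ord1 -e1 eqxx.
    by rewrite !(@col_mxEd _ 1).
by rewrite xrowE det_mulmx det_perm odd_tperm mulN1r opprK.
Qed.

Lemma dotp_crossQ_diag w : dotp w (crossQ w) = 0.
Proof.
have /eqP := dotp_crossQC w w; rewrite -addr_eq0 -mulr2n mulrn_eq0 /=.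
by move/eqP.
Qed.

Lemma row_crossQ a w : dotp (row a Q) (crossQ w) = 0.
Proof.
rewrite dotp_crossQ.
apply: (@determinant_alternate _ _ _ (lshift m.+1 (0 : 'I_1)) (rshift 1 (rshift 1 a))).
  by rewrite -val_eqE.
by move=> b; rewrite (@col_mxEu _ 1) !(@col_mxEd _ 1) mxE.
Qed.

(** The cross product of [v] with the rows of [Q] is the projection of [v] to the
    plane of [u] and [w], turned by a right angle and scaled. Products with [u], [w] and the
    rows of [Q] determine a vector, since these form a basis; antisymmetry
    reduces the products of the cross product of [v] to the cases [v = u] and
    [v = w], which again are settled by their products with the basis. *)
Lemma cross_in_plane u w :
  (forall a, dotp (row a Q) w = 0) -> (forall a, dotp (row a Q) u = 0) ->
  dotp u w = 0 -> 0 < dotp u u -> 0 < dotp w w ->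
  (forall c : 'rV_m, c *m Q = 0 -> c = 0) ->
  exists2 c, c != 0 & forall v,
    cross (col_mx v Q : 'M[R]_(m.+1, m.+2)) = c *: (dotp v w *: u - dotp v u *: w).
Proof.
move=> Qw Qu uw uu ww Qfree.
pose B : 'M[R]_m.+2 := col_mx u (col_mx w Q : 'M[R]_(m.+1, m.+2)).
have Qt x : (forall a, dotp (row a Q) x = 0) -> forall c : 'rV_m, dotp (c *m Q) x = 0.
  move=> Qx c; rewrite dotpE -mulmxA (_ : Q *m x^T = 0) ?mulmx0 ?mxE //.
  apply/matrixP => a b; rewrite [RHS]mxE -(Qx a) dotpE -row_mul [RHS]mxE ord1 //.
(* a vanishing combination of the rows, multiplied by [u] and by [w], loses its
   coefficients on [u] and [w] *)
have Bunit : B \in unitmx.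
  rewrite -row_free_unit -kermx_eq0; apply/rowV0P => z /sub_kermxP.
  rewrite -(@hsubmxK _ 1 1 m.+1 z).
  move: (@lsubmx _ 1 1 m.+1 z) (@rsubmx _ 1 1 m.+1 z) => za z'.
  rewrite -(@hsubmxK _ 1 1 m z').
  move: (@lsubmx _ 1 1 m z') (@rsubmx _ 1 1 m z') => zb zc.
  rewrite /B (@mul_row_col _ 1 1) (@mul_row_col _ 1 1).
  rewrite {1}(mx11_scalar za) {1}(mx11_scalar zb) !mul_scalar_mx => E.
  have a0 : za 0 0 = 0.
    have := congr1 (dotp^~ u) E.
    rewrite !dotpDl !dotpZl Qt // [dotp w u]dotpC uw mulr0 !addr0.
    rewrite (_ : dotp 0 u = 0); last by rewrite -(scale0r u) dotpZl mul0r.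
    by move/eqP; rewrite mulf_eq0 (gt_eqF uu) orbF => /eqP.
  have b0 : zb 0 0 = 0.
    have := congr1 (dotp^~ w) E.
    rewrite !dotpDl !dotpZl Qt // uw mulr0 !addr0 add0r.
    rewrite (_ : dotp 0 w = 0); last by rewrite -(scale0r u) dotpZl mul0r.
    by move/eqP; rewrite mulf_eq0 (gt_eqF ww) orbF => /eqP.
  move: E; rewrite a0 b0 !scale0r !add0r => /Qfree ->.
  by rewrite (mx11_scalar za) (mx11_scalar zb) a0 b0 !raddf0 !row_mx0.
have ext x y : dotp u x = dotp u y -> dotp w x = dotp w y ->
    (forall a, dotp (row a Q) x = dotp (row a Q) y) -> x = y.
  move=> xu xw xQ; apply: trmx_inj; apply: (can_inj (mulKmx Bunit)).
  have Eu : u *m x^T = u *m y^T.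
    by apply/matrixP => a b; rewrite !ord1 -!dotpE.
  have Ew : w *m x^T = w *m y^T.
    by apply/matrixP => a b; rewrite !ord1 -!dotpE.
  have EQ : Q *m x^T = Q *m y^T.
    by apply/matrixP => a b; rewrite !ord1 -!dotp_row !(dotpC _ (row a Q)).
  by rewrite /B !(@mul_col_mx _ 1) Eu Ew EQ.
pose d := \det B.
have d0 : d != 0 by move: Bunit; rewrite unitmxE unitfE.
have dE : dotp u (crossQ w) = d by rewrite dotp_crossQ.
pose c := d / (dotp u u * dotp w w).
have Tu : crossQ u = - (c * dotp u u) *: w.
  apply: ext => [||a]; rewrite ?dotpZr.
  - by rewrite dotp_crossQ_diag uw mulr0.
  - by rewrite dotp_crossQC dE /c; field; rewrite !gt_eqF.
  - by rewrite row_crossQ Qw mulr0.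
have Tw : crossQ w = (c * dotp w w) *: u.
  apply: ext => [||a]; rewrite ?dotpZr.
  - by rewrite dE /c; field; rewrite !gt_eqF.
  - by rewrite dotp_crossQ_diag dotpC uw mulr0.
  - by rewrite row_crossQ Qu mulr0.
exists c; first by rewrite mulf_neq0 // invr_neq0 // mulf_neq0 ?gt_eqF.
move=> v; apply: ext => [||a]; rewrite dotpZr dotpDr -scaleNr !dotpZr.
- by rewrite dotp_crossQC Tu dotpZr uw; ring.
- by rewrite dotp_crossQC Tw dotpZr [dotp w u]dotpC uw; ring.
- by rewrite row_crossQ Qw Qu; ring.
Qed.

End Plane.
End CrossProduct.

(** * Goldman's curvature of the plane section *)

Section PlaneSection.
Context {R : realType} {n : nat}.
Variables (f : 'rV[R]_n -> R) (i j : 'I_n) (xi : 'rV[R]_n).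
Implicit Types (x eta : 'rV[R]_n).

Lemma gradE x k : grad f x 0 k = partial k f x.
Proof. by rewrite mxE. Qed.

Lemma udirE eta : i != j ->
  udir f i j eta
  = delta_mx 0 j - (partial j f eta / partial i f eta) *: delta_mx 0 i.
Proof.
move=> ij; apply/rowP => k; rewrite !mxE eqxx /=.
have [->|kj] := eqVneq k j; first by rewrite eq_sym (negbTE ij) mulr0 subr0.
by case: eqVneq => _; rewrite ?mulr1 ?mulr0 ?subr0 ?sub0r ?oppr0.
Qed.

Lemma dotp_udir eta : i != j -> partial i f eta != 0 ->
  dotp (udir f i j eta) (grad f eta) = 0.
Proof.
move=> ij fi; rewrite udirE // dotpBl dotpZl !(dotpC (delta_mx _ _)).
by rewrite !dotp_delta !gradE divfK ?subrr.
Qed.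

Lemma dotp_udir_gt0 eta : 0 < dotp (udir f i j eta) (udir f i j eta).
Proof. by apply: (@dotpp_gt0 _ _ _ j); rewrite mxE eqxx oner_eq0. Qed.

Lemma dotp_grad_gt0 eta : partial i f eta != 0 -> 0 < dotp (grad f eta) (grad f eta).
Proof. by move=> fi; apply: (@dotpp_gt0 _ _ _ i); rewrite mxE. Qed.

Definition pgrad (k : 'I_n) : 'rV[R]_n :=
  delta_mx 0 k + acoef f i j xi k i *: delta_mx 0 i
               + acoef f i j xi k j *: delta_mx 0 j.

Lemma pfunE k x : pfun f i j xi k x = dotp (x - xi) (pgrad k).
Proof. by rewrite !dotpDr !dotpZr !dotp_delta !mxE. Qed.

Lemma grad_pfun k x : grad (pfun f i j xi k) x = pgrad k.
Proof.
apply/rowP => l; rewrite mxE /partial /derive.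
apply: lim_near_cst => //; near=> h.
have h0 : h != 0 by near: h; exact: nbhs_dnbhs_neq.
rewrite /= !pfunE -[_ + x - xi]addrA (dotpDl (h *: _)) addrK dotpZl.
rewrite -[_ *: _]/(_ * _) mulKf //.
by rewrite dotpC dotp_delta.
Unshelve. all: by end_near. Qed.

Lemma pgrad_grad k : k != i -> k != j -> i != j -> partial i f xi != 0 ->
  dotp (pgrad k) (grad f xi) = 0.
Proof.
move=> ki kj ij fi; rewrite !dotpDl !dotpZl !(dotpC (delta_mx _ _)) !dotp_delta.
rewrite !gradE /acoef.
move: (partial i f xi) (partial j f xi) (partial k f xi) fi => a b c a0; field.
by rewrite gt_eqF // ltr_pwDl ?sqr_ge0 // exprn_even_gt0.
Qed.

Lemma pgrad_udir k : k != i -> k != j -> i != j -> partial i f xi != 0 ->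
  dotp (pgrad k) (udir f i j xi) = 0.
Proof.
move=> ki kj ij fi; rewrite !dotpDl !dotpZl !(dotpC (delta_mx _ _)) !dotp_delta.
rewrite !mxE eqxx (negbTE ki) (negbTE kj) (negbTE ij) eqxx /acoef.
move: (partial i f xi) (partial j f xi) (partial k f xi) fi => a b c a0; field.
by rewrite a0 gt_eqF // ltr_pwDl ?sqr_ge0 // exprn_even_gt0.
Qed.

End PlaneSection.

Lemma wedge_norm_plane (R : realType) n (u v : 'rV[R]_n) (a b c : R) :
  dotp u v = 0 ->
  wedge_norm (a *: u + b *: v) (c *: u) = `|b * c| * (enorm v * enorm u).
Proof.
move=> uv; rewrite wedge_normE.
have -> : dotp (a *: u + b *: v) (a *: u + b *: v) * dotp (c *: u) (c *: u)
    - dotp (a *: u + b *: v) (c *: u) ^+ 2 = (b * c * (enorm v * enorm u)) ^+ 2.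
  rewrite !exprMn !sqr_enorm !dotpDl !dotpDr !dotpZl !dotpZr (dotpC v) uv; ring.
rewrite sqrtr_sqr normrM; congr (_ * _).
by rewrite ger0_norm // mulr_ge0 // enorm_ge0.
Qed.

(** The gradients [pgrad k] are independent because the coordinates other than
    [i] and [j] of [pgrad k] are those of the [k]-th basis vector. *)
Lemma Tan_curve_eqs (R : realType) n (f : 'rV[R]_n -> R) (i j : 'I_n) xi :
  i != j -> partial i f xi != 0 ->
  let u := udir f i j xi in let N := grad f xi in
  exists2 c, c != 0 & forall x, Tan (curve_eqs f i j xi) x
    = c *: (dotp (grad f x) N *: u - dotp (grad f x) u *: N).
Proof.
case: n f i j xi => [|[|m]] f i j xi ij fi u N; first by case: (i).
  by move: ij; rewrite (ord1 i) (ord1 j) eqxx.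
pose s := enum (~: [set i; j]).
have s_size : size s = m.
  by rewrite -cardE cardsCs finset.setCK cards2 ij card_ord subn2.
pose k (a : 'I_m) := nth i s a.
have ks a : k a \in s by rewrite mem_nth // s_size.
have kP a : k a != i /\ k a != j.
  by have := ks a; rewrite mem_enum !inE negb_or => /andP[].
have kinj a b : (k a == k b) = (a == b).
  by rewrite nth_uniq ?s_size // ?enum_uniq.
pose Q : 'M[R]_(m, m.+2) := \matrix_a pgrad f i j xi (k a).
have [|||||z zQ|c c0 cE] := @cross_in_plane R m Q u N.
- by move=> a; rewrite rowK; have [ki kj] := kP a; exact: pgrad_grad.
- by move=> a; rewrite rowK; have [ki kj] := kP a; exact: pgrad_udir.
- exact: dotp_udir.
- exact: dotp_udir_gt0.
- exact: dotp_grad_gt0 fi.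
- apply/rowP => b; have := congr1 (fun M : 'rV_m.+2 => M 0 (k b)) zQ.
  have [bi bj] := kP b.
  rewrite !mxE (bigD1 b) //= big1 => [|a ab]; rewrite !mxE eqxx /=;
    move: (acoef _ _ _ _ _ i) (acoef _ _ _ _ _ j) => ai aj.
    by rewrite (negbTE bi) (negbTE bj) eqxx !mulr0 !addr0 mulr1.
  rewrite (negbTE bi) (negbTE bj) kinj [b == a]eq_sym (negbTE ab).
  by rewrite !mulr0 !addr0 mulr0.
exists c => // x; rewrite -cE.
have E : \matrix_(a < m.+1) grad (curve_eqs f i j xi a) x
    = (col_mx (grad f x) Q : 'M[R]_(m.+1, m.+2)).
  apply/row_matrixP => a; rewrite rowK.
  case: (@split_ordP 1 m a) => a' ->.
    by rewrite (@rowKu _ 1) ord1 row_id /curve_eqs.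
  rewrite (@rowKd _ 1) rowK /curve_eqs /= (nth_map i) ?grad_pfun //.
  by rewrite add0n -/s s_size.
by rewrite -E.
Qed.

(** The tangent field is [c (<grad f x, N> u - <grad f x, u> N)], so at [xi] it
    is [c |N|^2 u] and its derivative along itself has a component along [N]
    proportional to [q(u)], where [q] is the Hessian form; the component along
    [u] is lost in the wedge product. *)
Lemma goldman_curvatureE (R : realType) n (U : set 'rV[R]_n)
    (f : 'rV[R]_n -> R) (i j : 'I_n) xi :
  open U -> class_C 2 f U -> U xi -> i != j -> partial i f xi != 0 ->
  let u := udir f i j xi in let N := grad f xi in
  goldman_curvature (curve_eqs f i j xi) xi
  = `|qform (hess f xi) u| / (dotp u u * enorm N).
Proof.
move=> oU cf Ux ij fi u N.
have [c c0 TanE] := Tan_curve_eqs ij fi; rewrite -/u -/N in TanE.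
have uN : dotp u N = 0 by exact: dotp_udir.
have uu : 0 < dotp u u by exact: dotp_udir_gt0.
have NN : 0 < dotp N N by exact: dotp_grad_gt0 fi.
have T0 : Tan (curve_eqs f i j xi) xi = (c * dotp N N) *: u.
  by rewrite TanE -/N (dotpC N u) uN scale0r subr0 scalerA.
clearbody u N.
have TT : Tan (curve_eqs f i j xi) xi *m gradTan (curve_eqs f i j xi) xi
  = (c ^+ 2 * dotp N N * dotp (N *m hess f xi) u) *: u
    + (- (c ^+ 2 * dotp N N * qform (hess f xi) u)) *: N.
  apply/rowP => s; rewrite mxE.
  have der t : gradTan (curve_eqs f i j xi) xi t s
      = c * (u 0 s * (N *m hess f xi) 0 t - N 0 s * (u *m hess f xi) 0 t).
    rewrite !mxE /partial.
    have -> : (fun y => Tan (curve_eqs f i j xi) y 0 s)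
      = (c * u 0 s) *: (fun y => dotp N (grad f y))
        - (c * N 0 s) *: (fun y => dotp u (grad f y)).
      apply/funext => y; rewrite TanE !mxE (dotpC _ N) (dotpC _ u).
      by rewrite -[RHS]/(c * u 0 s * dotp N (grad f y)
        - c * N 0 s * dotp u (grad f y)); ring.
    have dN := is_derive_dotp_grad (delta_mx 0 t) N oU cf Ux.
    have du := is_derive_dotp_grad (delta_mx 0 t) u oU cf Ux.
    have dT := is_deriveB (is_deriveZ (c * u 0 s) dN) (is_deriveZ (c * N 0 s) du).
    rewrite (@derive_val _ _ _ _ _ _ _ dT).
    by rewrite !dotp_delta -![_ *: _]/(_ * _) !mxE; ring.
  under eq_bigr => t _ do rewrite der T0 mxE.
  rewrite [RHS]mxE [in RHS]mxE [X in _ + X]mxE /qform.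
  set d := dotp N N; clearbody d; rewrite /dotp.
  rewrite (eq_bigr (fun t => c ^+ 2 * d * u 0 s * ((N *m hess f xi) 0 t * u 0 t)
     - c ^+ 2 * d * N 0 s * ((u *m hess f xi) 0 t * u 0 t))); last first.
    by move=> t _; ring.
  by rewrite sumrB -!mulr_sumr; ring.
rewrite /goldman_curvature TT T0 wedge_norm_plane // enormZ.
have nu : 0 < enorm u by rewrite enorm_gt0.
have nN : 0 < enorm N by rewrite enorm_gt0.
have nc : 0 < `|c| by rewrite normr_gt0.
rewrite -!sqr_enorm !(normrM, normrN, normrX) !(gtr0_norm nN); field.
by rewrite !gt_eqF.
Qed.

Lemma qformB (R : realType) n (H K : 'M[R]_n) h :
  qform H h - qform K h = \sum_l \sum_k (H k l - K k l) * (h 0 k * h 0 l).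
Proof.
rewrite /qform /dotp -sumrB; apply: eq_bigr => l _; rewrite !mxE -mulrBl.
by rewrite -sumrB mulr_suml; apply: eq_bigr => k _; ring.
Qed.

(** * The convex body near a boundary point *)

Section LocalConvexity.
Context {R : realType} {n : nat}.
Variables (F : set 'rV[R]_n) (f : 'rV[R]_n -> R) (U : set 'rV[R]_n).
Hypotheses (Fclosed : closed F) (Fconvex : convex_set F) (F0 : interior F 0).
Hypotheses (oU : open U) (fC2 : class_C 2 f U).
Hypothesis (Ff : F `<=` [set x | f x <= 0]).
Hypothesis (bF : forall x, U x -> (boundary F x <-> f x = 0)).
Implicit Types (x y eta h : 'rV[R]_n) (t s r e : R).

Lemma boundary_mem x : boundary F x -> F x.
Proof. by move=> [/Fclosed]. Qed.

Lemma convex_mem x y t : F x -> F y -> 0 <= t -> t <= 1 ->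
  F (t *: x + (1 - t) *: y).
Proof.
move=> Fx Fy t0 t1.
have /(_ x y (Itv01 t0 t1)) := Fconvex.
by rewrite !inE => /(_ Fx Fy).
Qed.

(** A positive derivative at [eta] towards a point of [F] would produce points
    of [F] with [f > 0]. *)
Lemma grad_support eta y : F eta -> U eta -> f eta = 0 -> F y ->
  dotp (y - eta) (grad f eta) <= 0.
Proof.
move=> Fe Ue fe Fy; rewrite leNgt; apply/negP => d0.
have [cv dv] := class_C_is_derive (y - eta) oU fC2 Ue.
have /cvgr_gt /(_ _ d0) :
    (fun t : R => t^-1 *: ((f \o shift eta) (t *: (y - eta)) - f eta))
    @ 0^'+ --> dotp (y - eta) (grad f eta).
  rewrite -dv; apply: cvg_trans cv; apply: cvg_app.
  by apply: within_subset => t /=; rewrite lt_neqAle eq_sym => /andP[].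
move=> pos; near (0 : R)^'+ => t.
have t0 : 0 < t by near: t; exact: nbhs_right_gt.
have t1 : t <= 1 by near: t; exact: nbhs_right_le.
have : 0 < t^-1 *: ((f \o shift eta) (t *: (y - eta)) - f eta).
  by near: t; exact: pos.
rewrite /= fe subr0 -[_ *: f _]/(_ * _) pmulr_rgt0 ?invr_gt0 // ltNge.
have -> : t *: (y - eta) + eta = t *: y + (1 - t) *: eta.
  by rewrite scalerBr scalerBl scale1r addrAC addrA.
by rewrite Ff // ; apply: convex_mem => //; exact: ltW.
Unshelve. all: by end_near. Qed.

(** Along the ray through [y] the function [f] increases where
    [dotp x (grad f x) > 0], so it stays negative on [[s0 *: y, y]]; that
    segment misses the boundary, and being connected it stays in [F]. *)
Lemma radial_mem y s0 : 0 < s0 -> s0 <= 1 ->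
  (forall s, s \in `[s0, 1] -> U (s *: y) /\ 0 < dotp (s *: y) (grad f (s *: y))) ->
  F (s0 *: y) -> f y < 0 -> F y.
Proof.
move=> s0_gt0 s0_le1 seg Fs0 fy.
have neg s : s \in `[s0, 1] -> f (s *: y) < 0.
  move=> s01; have /andP[s0s s1] : s0 <= s <= 1 by move: s01; rewrite in_itv.
  have sub t : t \in `[s, 1] -> t \in `[s0, 1].
    by rewrite !in_itv /= => /andP[st ->]; rewrite (le_trans s0s st).
  pose g (t : R) := f (0 + t *: y).
  pose g' (t : R) := dotp y (grad f (t *: y)).
  have dg (t : R) : t \in `[s, 1] -> is_derive t 1 g (g' t).
    move=> /sub /seg [Ut _]; apply: is_derive_line; rewrite add0r.
    exact: class_C_is_derive oU fC2 Ut.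
  have gcont : {within `[s, 1], continuous g}.
    by apply: derivable_within_continuous => t /dg [].
  have dg' (t : R) : t \in `]s, 1[ -> is_derive t 1 g (g' t).
    by move=> /subset_itv_oo_cc; exact: dg.
  have [t ts E] := MVT_segment s1 dg' gcont.
  have t0 : 0 < t.
    by move: (sub _ ts); rewrite in_itv /= => /andP[/(lt_le_trans s0_gt0)].
  have [_] := seg _ (sub _ ts); rewrite dotpZl pmulr_rgt0 // => d0.
  move: E; rewrite /g /g' !add0r scale1r => E.
  apply: le_lt_trans fy; rewrite -subr_ge0 E mulr_ge0 // ?subr_ge0 //.
  exact: ltW.
have scont : continuous (fun s : R => s *: y) by exact: scalel_continuous.
pose B := `[s0, 1]%classic `&` (fun s : R => s *: y) @^-1` F.
have BE : B = `[s0, 1]%classic.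
  apply: segment_connected.
  - by exists s0; split=> //=; rewrite in_itv /= lexx.
  - exists ((fun s : R => s *: y) @^-1` (interior F)).
      by apply: open_comp; [move=> s _; exact: scont|exact: open_interior].
    rewrite /B; apply/seteqP; split=> s /= [s01 Fs]; split; [exact: s01| |exact: s01|].
      apply: contrapT => nFs.
      have [Us _] := seg s s01.
      have : boundary F (s *: y).
        by split; [exact: subset_closure|exact: nFs].
      by move=> /(bF Us) fs0; have := neg s s01; rewrite fs0 ltxx.
    exact: interior_subset Fs.
  - exists ((fun s : R => s *: y) @^-1` F) => //.
    by apply: closed_comp => // s _; exact: scont.
have : B 1 by rewrite BE /= in_itv /= lexx andbT.
by move=> [_ /=]; rewrite scale1r.
Qed.

Lemma cvg_grad xi : U xi -> grad f @ xi --> grad f xi.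
Proof.
move=> Uxi; apply: (@cvg_row _ _ _ (nbhs xi)) => k; rewrite mxE.
under eq_fun do rewrite mxE.
exact: class_C_continuous (class_C_partial k fC2) Uxi.
Qed.

(** For [s0 < 1] close to [1] the point [s0 *: y] is a convex combination of
    [xi] and a small vector, so it lies in [F] as soon as [y] is close to [xi];
    [radial_mem] then applies to the short segment from [s0 *: y] to [y]. *)
Lemma near_sublevel_mem xi : F xi -> U xi -> 0 < dotp xi (grad f xi) ->
  \forall y \near xi, f y < 0 -> F y.
Proof.
move=> Fxi Uxi gxi.
have cgrad := cvg_grad Uxi.
have cg : (fun z => dotp z (grad f z)) @ xi --> dotp xi (grad f xi).
  exact: (@cvg_dotp _ _ _ (nbhs xi) _ id (grad f) xi (grad f xi) cvg_id cgrad).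
have nearW : \forall z \near xi, U z /\ 0 < dotp z (grad f z).
  apply: filterI; first exact: (open_nbhs_nbhs (conj oU Uxi)).
  exact: (cvgr_gt _ cg _ gxi).
have [rho /= rho0 rhoP] := (nbhs_ballP _ _).1 nearW.
have [r /= r0 rF] := (nbhs_ballP _ _).1 F0.
(* [1 - tau] serves as [s0]; the bound on [tau] keeps the segment in the ball *)
pose tau := Num.min (1 / 2) (rho / 2 / (`|xi| + rho)).
have xr0 : 0 < `|xi| + rho by rewrite ltr_wpDl.
have tau0 : 0 < tau by rewrite lt_min !divr_gt0.
have tau1 : tau <= 1 / 2 by rewrite ge_min lexx.
have tauM : tau * (`|xi| + rho) <= rho / 2.
  by rewrite -ler_pdivlMr // ge_min lexx orbT.
pose s0 := 1 - tau.
have s0_gt0 : 0 < s0 by rewrite /s0; lra.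
near=> y.
move=> fy.
have s0_le1 : s0 <= 1 by rewrite /s0; lra.
have seg (s : R) : s \in `[s0, 1] ->
    U (s *: y) /\ 0 < dotp (s *: y) (grad f (s *: y)).
  rewrite in_itv /= => /andP[s0s s1]; apply: rhoP; rewrite -ball_normE /=.
  have yx : `|xi - y| < rho / 2.
    near: y; have := @nbhsx_ballx _ _ xi (rho / 2); rewrite -ball_normE.
    by apply; rewrite divr_gt0.
  have -> : xi - s *: y = (xi - y) + (1 - s) *: y.
    by rewrite scalerBl scale1r addrA subrK.
  apply: le_lt_trans (ler_normD _ _) _; rewrite normrZ.
  rewrite (ger0_norm (_ : 0 <= 1 - s)) ?subr_ge0 //.
  have y_le : `|y| <= `|xi| + rho.
    rewrite -[y](subKr xi); apply: le_trans (ler_normB _ _) _; lra.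
  have : (1 - s) * `|y| <= tau * (`|xi| + rho).
    by apply: ler_pM => //; rewrite ?subr_ge0 // /s0 in s0s *; lra.
  lra.
have Fs0 : F (s0 *: y).
  have -> : s0 *: y = s0 *: xi + (1 - s0) *: ((s0 / tau) *: (y - xi)).
    rewrite scalerA (_ : (1 - s0) * (s0 / tau) = s0).
      by rewrite scalerBr addrCA subrr addr0.
    by rewrite /s0; field; rewrite gt_eqF.
  apply: (convex_mem Fxi _ (ltW s0_gt0) s0_le1).
  apply: rF; rewrite -ball_normE /= sub0r normrN normrZ gtr0_norm ?divr_gt0 //.
  rewrite distrC mulrC -ltr_pdivlMr ?divr_gt0 //.
  near: y; have := @nbhsx_ballx _ _ xi (r / (s0 / tau)); rewrite -ball_normE.
  by apply; rewrite !divr_gt0.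
exact: (radial_mem s0_gt0 s0_le1 seg Fs0 fy).
Unshelve. all: by end_near. Qed.

(** The Hessian in the Lagrange remainder is taken on the segment from [eta] to
    [eta + h], where by continuity its entries are close to those at [xi]; only
    the distance to [xi] matters, hence the uniformity in [eta]. *)
Lemma taylor2_uniform xi e : U xi -> 0 < e ->
  exists2 rho, 0 < rho & forall eta h,
    `|xi - eta| < rho -> `|xi - (eta + h)| < rho ->
    `|f (eta + h) - (f eta + dotp h (grad f eta) + qform (hess f xi) h / 2)|
      <= e * dotp h h.
Proof.
move=> Uxi e0.
pose d := e / (n * n).+1%:R.
have d0 : 0 < d by rewrite divr_gt0.
pose C z (kl : 'I_n * 'I_n) := `|hess f xi kl.1 kl.2 - hess f z kl.1 kl.2| <= d.
have nearW : \forall z \near xi, U z /\ forall kl, C z kl.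
  apply: filterI; first exact: (open_nbhs_nbhs (conj oU Uxi)).
  apply: (@filter_forall _ _ (fun kl z => C z kl) (nbhs xi)) => kl.
  case: kl => k l.
  have cH : {for xi, continuous (partial l (partial k f))}.
    exact: class_C_continuous (class_C_partial l (class_C_partial k fC2)) Uxi.
  have near_H := (cvgrPdist_le _ _).1 cH _ d0.
  apply: filterS (near_H (nbhs_filter xi)) => z zH.
  suff -> : C z (k, l)
      = (`|partial l (partial k f) xi - partial l (partial k f) z| <= d).
    exact: zH.
  by congr (`|_ - _| <= _); rewrite mxE.
have [rho /= rho0 rhoP] := (nbhs_ballP _ _).1 nearW.
exists rho => // eta h he hh.
have seg (t : R) : t \in `[0, 1] -> `|xi - (eta + t *: h)| < rho.
  rewrite in_itv /= => /andP[t0 t1].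
  have -> : xi - (eta + t *: h) = (1 - t) *: (xi - eta) + t *: (xi - (eta + h)).
    by apply/rowP => k; rewrite !mxE; ring.
  apply: le_lt_trans (ler_normD _ _) _; rewrite !normrZ.
  rewrite (ger0_norm t0) (ger0_norm (_ : 0 <= 1 - t)) ?subr_ge0 //.
  have [-> |t_neq0] := eqVneq t 0; first by rewrite subr0 mul1r mul0r addr0.
  have tp : 0 < t by rewrite lt_neqAle eq_sym t_neq0.
  by nra.
have ballW z : `|xi - z| < rho -> U z /\ forall kl, C z kl.
  by move=> zr; apply: rhoP; rewrite -ball_normE.
have [|t t01 E] := @taylor2 _ _ f U eta h oU fC2.
  by move=> t /seg /ballW [].
have [_ close] := ballW _ (seg t t01).
move: (eta + t *: h) close E => z close ->.
rewrite opprD addrACA subrr add0r -mulrBl normrM [X in _ * X]ger0_norm //.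
rewrite ler_pdivrMr //.
rewrite qformB.
apply: (@le_trans _ _ (\sum_(l < n) \sum_(k < n) d * dotp h h)).
  apply: le_trans (ler_norm_sum _ _ _) _; apply: ler_sum => l _.
  apply: le_trans (ler_norm_sum _ _ _) _; apply: ler_sum => k _.
  rewrite !normrM; apply: ler_pM => //; first by rewrite distrC; exact: (close (k, l)).
  by rewrite -sqr_enorm expr2; apply: ler_pM => //; exact: coord_le_enorm.
rewrite !sumr_const card_ord -mulrnA -mulrnAl.
apply: (@le_trans _ _ (e * dotp h h)).
  apply: ler_wpM2r; first exact: dotpp_ge0.
  by rewrite -mulr_natr /d -mulrA ger_pMr // mulrC ler_pdivrMr // mul1r ler_nat.
by rewrite ler_peMr ?mulr_ge0 ?dotpp_ge0 ?ltW // ltr1n.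
Qed.

End LocalConvexity.

(** * Depth of the points of a plane section *)

Section QuadraticEstimate.
Context {R : realType}.
Implicit Types (sn su qu qun qn : R).

(** Let [a N + b u] have norm [r]. Eliminating [b^2] from the form at this
    vector leaves [r^2 q(u) / |u|^2] and a remainder, which is at most [2 r]
    times this number times the depth [- a |N|^2]. Here [sn], [su] are the norms
    of [N], [u], and [qn], [qu], [qun] the values of the form on [N], on [u]
    and on the mixed pair. *)
Definition mixed_bound sn su qu qun qn : R :=
  ((`|sn ^+ 2 * qu / su ^+ 2| + `|qn|) / sn + `|qun| / su) / (2 * sn ^+ 2).

Lemma mixed_bound_ge0 sn su qu qun qn : 0 < sn -> 0 < su ->
  0 <= mixed_bound sn su qu qun qn.
Proof.
move=> sn0 su0; rewrite divr_ge0 ?addr_ge0 ?divr_ge0 ?addr_ge0 //; try exact: ltW.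
by rewrite mulr_ge0 // sqr_ge0.
Qed.

(** The hypothesis bounds the form by twice the depth. Eliminating [b^2] leaves
    [r^2 q(u) / |u|^2] and a remainder with a factor [a], that is, a remainder
    small compared with the depth itself, which absorbs it. *)
Lemma quadratic_lower_bound sn su qu qun qn (r a b e : R) :
  0 < sn -> 0 < su -> 0 < r -> a <= 0 ->
  r ^+ 2 = a ^+ 2 * sn ^+ 2 + b ^+ 2 * su ^+ 2 ->
  a ^+ 2 * qn + a * b * qun + b ^+ 2 * qu - e * r ^+ 2 <= 2 * (- (a * sn ^+ 2)) ->
  (qu / su ^+ 2 - e) * r ^+ 2
    <= 2 * (- (a * sn ^+ 2)) * (1 + r * mixed_bound sn su qu qun qn).
Proof.
move=> sn0 su0 r0 a0 rE qA.
have an : `|a| * sn <= r.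
  rewrite -ler_sqr ?nnegrE ?mulr_ge0 //; try exact: ltW.
  by rewrite exprMn real_normK ?num_real // rE lerDl mulr_ge0 // sqr_ge0.
have bn : `|b| * su <= r.
  rewrite -ler_sqr ?nnegrE ?mulr_ge0 //; try exact: ltW.
  by rewrite exprMn real_normK ?num_real // rE lerDr mulr_ge0 // sqr_ge0.
pose X := sn ^+ 2 * qu / su ^+ 2.
(* what remains of the form, divided by [a], after eliminating [b^2] *)
pose E := - a * X + b * qun + a * qn.
have qE : a ^+ 2 * qn + a * b * qun + b ^+ 2 * qu = r ^+ 2 * qu / su ^+ 2 + a * E.
  by rewrite rE /E /X; field; rewrite gt_eqF.
pose M := (`|X| + `|qn|) / sn + `|qun| / su.
have EM : `|E| <= r * M.
  have an' : `|a| <= r / sn by rewrite ler_pdivlMr.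
  have bn' : `|b| <= r / su by rewrite ler_pdivlMr.
  have -> : r * M = r / sn * `|X| + r / su * `|qun| + r / sn * `|qn|.
    by rewrite /M; ring.
  apply: le_trans (ler_normD _ _) _; apply: lerD; last first.
    by rewrite normrM ler_wpM2r.
  apply: le_trans (ler_normD _ _) _; apply: lerD; last by rewrite normrM ler_wpM2r.
  by rewrite normrM normrN ler_wpM2r.
have aE : a * (r * M) <= a * E.
  by apply: ler_wnM2l => //; exact: le_trans (ler_norm _) EM.
have -> : 2 * (- (a * sn ^+ 2)) * (1 + r * mixed_bound sn su qu qun qn)
    = 2 * (- (a * sn ^+ 2)) - a * (r * M).
  by rewrite /mixed_bound -/X -/M; field; rewrite gt_eqF.
have -> : (qu / su ^+ 2 - e) * r ^+ 2 = r ^+ 2 * qu / su ^+ 2 - e * r ^+ 2 by ring.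
by rewrite qE in qA; lra.
Qed.

End QuadraticEstimate.

Section Depth.
Context {R : realType} {n : nat}.
Variables (F : set 'rV[R]_n) (f : 'rV[R]_n -> R) (U : set 'rV[R]_n).
Hypotheses (Fclosed : closed F) (Fconvex : convex_set F).
Hypotheses (oU : open U) (fC2 : class_C 2 f U).
Hypothesis (Ff : F `<=` [set x | f x <= 0]).
Hypothesis (bF : forall x, U x -> (boundary F x <-> f x = 0)).
Variables (xi : 'rV[R]_n) (i j : 'I_n).
Hypotheses (ij : i != j).
Implicit Types (eta h y : 'rV[R]_n).

Local Notation N := (grad f).
Local Notation u := (udir f i j).
Local Notation H := (hess f xi).

Definition qmix (v w : 'rV[R]_n) : R := dotp (v *m H) w + dotp (w *m H) v.

Lemma qform_comb (v w : 'rV[R]_n) a b : qform H (a *: v + b *: w)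
  = a ^+ 2 * qform H v + a * b * qmix v w + b ^+ 2 * qform H w.
Proof.
rewrite /qform /qmix mulmxDl -!scalemxAl !dotpDl !dotpDr !dotpZl !dotpZr; ring.
Qed.

Lemma planeP eta v y :
  plane f eta v y <-> exists a b, y - eta = a *: N eta + b *: v.
Proof.
rewrite /plane /= span_cons span_seq1; split.
  by move=> /memv_addP[_ /vlineP[a ->] [_ /vlineP[b ->] ->]]; exists a, b.
move=> [a [b ->]]; apply/memv_addP; exists (a *: N eta).
  by apply/vlineP; exists a.
by exists (b *: v) => //; apply/vlineP; exists b.
Qed.

Definition section_bound eta : R := mixed_bound (enorm (N eta)) (enorm (u eta))
  (qform H (u eta)) (qmix (N eta) (u eta)) (qform H (N eta)).

(** By convexity only the points at distance exactly [r] matter: the depth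
    grows linearly on the ray from [eta] to [y]. There Taylor's formula and
    [f <= 0] bound the form by twice the depth, up to [e r^2]. *)
Lemma depth_lower_bound rho e r eta y :
  (forall eta h, `|xi - eta| < rho -> `|xi - (eta + h)| < rho ->
    `|f (eta + h) - (f eta + dotp h (N eta) + qform H h / 2)| <= e / 2 * dotp h h) ->
  boundary F eta -> U eta -> partial i f eta != 0 ->
  0 < r -> `|xi - eta| + r < rho ->
  F y -> plane f eta (u eta) y -> r <= enorm (eta - y) ->
  (qform H (u eta) / dotp (u eta) (u eta) - e) * r ^+ 2
    <= 2 * dotp (eta - y) (N eta) * (1 + r * section_bound eta).
Proof.
move=> taylor Beta Ueta fi r0 rrho Fy /planeP[a0 [b0 yE]] ry.
have Feta := boundary_mem Fclosed Beta.
have feta : f eta = 0 by apply/bF.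
have d0 : 0 < enorm (eta - y) by exact: lt_le_trans r0 ry.
pose s := r / enorm (eta - y).
have s0 : 0 < s by rewrite divr_gt0.
have s1 : s <= 1 by rewrite ler_pdivrMr ?mul1r.
pose h := s *: (y - eta).
have hE : h = (s * a0) *: N eta + (s * b0) *: u eta.
  by rewrite /h yE scalerDr !scalerA.
have Fh : F (eta + h).
  have -> : eta + h = s *: y + (1 - s) *: eta.
    by rewrite /h; apply/rowP => k; rewrite !mxE; ring.
  exact: (convex_mem Fconvex Fy Feta (ltW s0) s1).
have rh : enorm h = r.
  rewrite enormZ (gtr0_norm s0) -opprB enormN /s divfK //; exact: lt0r_neq0.
have uN : dotp (u eta) (N eta) = 0 by exact: dotp_udir.
have hN : dotp h (N eta) = s * a0 * dotp (N eta) (N eta).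
  by rewrite hE dotpDl !dotpZl uN mulr0 addr0.
have sup : 0 <= dotp (eta - y) (N eta).
  have := grad_support Fconvex oU fC2 Ff Feta Ueta feta Fy.
  by rewrite -opprB dotpNl oppr_le0.
have hA : dotp h (N eta) = - (s * dotp (eta - y) (N eta)).
  by rewrite /h dotpZl -opprB dotpNl mulrN.
have NN : 0 < dotp (N eta) (N eta) by exact: dotp_grad_gt0 fi.
have sn0 : 0 < enorm (N eta) by rewrite enorm_gt0.
have su0 : 0 < enorm (u eta) by rewrite enorm_gt0; exact: dotp_udir_gt0.
have a_le0 : s * a0 <= 0.
  rewrite -(pmulr_lle0 _ NN) -hN hA oppr_le0 mulr_ge0 //; exact: ltW.
have bound_ge0 : 0 <= 1 + r * section_bound eta.
  rewrite addr_ge0 // mulr_ge0 //; first exact: ltW.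
  exact: mixed_bound_ge0.
have hh : dotp h h = r ^+ 2 by rewrite -sqr_enorm rh.
have rE : r ^+ 2 = (s * a0) ^+ 2 * enorm (N eta) ^+ 2
    + (s * b0) ^+ 2 * enorm (u eta) ^+ 2.
  rewrite -hh hE !dotpDl !dotpDr !dotpZl !dotpZr (dotpC (N eta) (u eta)) uN.
  by rewrite !sqr_enorm; ring.
have close : `|xi - (eta + h)| < rho.
  rewrite opprD addrA; apply: le_lt_trans (ler_normB _ _) _.
  apply: le_lt_trans rrho; rewrite lerD2l -rh; exact: norm_le_enorm.
have close0 : `|xi - eta| < rho.
  by apply: lt_trans rrho; rewrite ltrDl.
have fh : f (eta + h) <= 0 by exact: Ff Fh.
have T := taylor eta h close0 close.
rewrite feta add0r hh in T.
have qA : (s * a0) ^+ 2 * qform H (N eta) + s * a0 * (s * b0) * qmix (N eta) (u eta)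
    + (s * b0) ^+ 2 * qform H (u eta) - e * r ^+ 2
    <= 2 * (- (s * a0 * enorm (N eta) ^+ 2)).
  rewrite -qform_comb -hE sqr_enorm -hN.
  move: T; rewrite ler_norml => /andP[T _]; lra.
have := quadratic_lower_bound sn0 su0 r0 a_le0 rE qA.
rewrite !sqr_enorm -hN hA opprK -/(section_bound eta) => L.
apply: (le_trans L); apply: ler_wpM2r => //.
by rewrite ler_pM2l // ler_piMl.
Qed.

End Depth.

(** * The limit of the normalized modulus *)

Lemma limf_einf_fin (R : realType) (T : choiceType) (X : filteredType T)
    (G : set_system X) (phi : X -> \bar R) (K : R) : ProperFilter G ->
  (forall c, c < K -> \forall p \near G, (c%:E <= phi p)%E) ->
  (forall c, K < c -> \forall p \near G, (phi p <= c%:E)%E) ->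
  limf_einf phi G = K%:E.
Proof.
move=> PG lo up; rewrite limf_einfE; apply/eqP; rewrite eq_le; apply/andP; split.
- apply: ge_ereal_sup => _ [V GV <-]; apply/lee_addgt0Pr => e e0.
  have Ke : K < K + e by rewrite ltrDl.
  have [p [Vp phip]] := filter_ex (filterI GV (up _ Ke)).
  apply: ge_ereal_inf; exists (phi p); first by exists p.
  by rewrite -EFinD.
- apply/lee_subgt0Pr => e e0.
  have Ke : K - e < K by rewrite ltrBlDr ltrDl.
  apply: le_ereal_sup_tmp; exists (ereal_inf (phi @` [set p | (K - e)%:E <= phi p]%E)).
    by exists [set p | ((K - e)%:E <= phi p)%E] => //; exact: lo.
  by rewrite -EFinB; apply: le_ereal_inf_tmp => _ [p Kp <-].
Qed.

Lemma depth_div (R : realType) (q g b A r : R) : 0 < g -> 0 < b ->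
  q * r ^+ 2 <= 2 * A * b -> q / 2 / (b * g) * r ^+ 2 * g <= A.
Proof.
move=> g0 b0 qA; rewrite -(ler_pM2r (_ : 0 < 2 * b)) ?mulr_gt0 //.
have -> : q / 2 / (b * g) * r ^+ 2 * g * (2 * b) = q * r ^+ 2.
  by field; rewrite !lt0r_neq0.
by rewrite [leRHS](_ : _ = 2 * A * b); [exact: qA|ring].
Qed.

Section DirectionalLimit.
Context {R : realType} {n : nat}.
Variables (F : set 'rV[R]_n) (f : 'rV[R]_n -> R) (U : set 'rV[R]_n).
Hypotheses (Fclosed : closed F) (Fconvex : convex_set F) (F0 : interior F 0).
Hypotheses (oU : open U) (fC2 : class_C 2 f U).
Hypothesis (Ff : F `<=` [set x | f x <= 0]).
Hypothesis (bF : forall x, U x -> (boundary F x <-> f x = 0)).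
Variables (xi : 'rV[R]_n) (i j : 'I_n).
Hypotheses (Uxi : U xi) (bxi : boundary F xi) (gxi : 0 < dotp xi (grad f xi)).
Hypotheses (ij : i != j) (fi : partial i f xi != 0).
Implicit Types (eta h y : 'rV[R]_n) (p : R * 'rV[R]_n).

Local Notation N := (grad f).
Local Notation u := (udir f i j).
Local Notation H := (hess f xi).
Local Notation Fil := (filter_prod (0 : R)^'+ (within (boundary F) (nbhs xi))).

Let Fil_proper : ProperFilter Fil.
Proof.
have pw : ProperFilter (within (boundary F) (nbhs xi)).
  by apply: within_nbhs_proper; exact: subset_closure.
exact: (@filter_prod_proper _ _ _ _ (at_right_proper_filter (0 : R)) pw).
Qed.

Let Fil_filter : Filter Fil.
Proof. exact: filter_prod_filter. Qed.

Let cvg_radius : (fun p => p.1) @ Fil --> (0 : R).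
Proof. by apply: cvg_trans (@cvg_within _ _ _ _); exact: cvg_fst. Qed.

Let cvg_base : (fun p => p.2) @ Fil --> xi.
Proof.
have c2 : (fun p => p.2) @ Fil --> within (boundary F) (nbhs xi) by exact: cvg_snd.
exact: cvg_trans c2 (cvg_within _).
Qed.

Let cvg_normal : (fun p => N p.2) @ Fil --> N xi.
Proof. exact: (cvg_comp _ _ cvg_base (cvg_grad fC2 Uxi)). Qed.

Let cvg_udir : (fun p => u p.2) @ Fil --> u xi.
Proof.
have cpart k : (fun p => partial k f p.2) @ Fil --> partial k f xi.
  rewrite -gradE (_ : (fun p => _) = (fun p => N p.2 0 k)).
    exact: (cvg_coord cvg_normal).
  by apply/funext => p; rewrite gradE.
apply: cvg_row => k; rewrite mxE.
rewrite (_ : (fun p => _) = (fun p => if k == j then 1 else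
    if k == i then - (partial j f p.2 / partial i f p.2) else 0)); last first.
  by apply/funext => p; rewrite mxE.
case: eqP => _; first exact: cvg_cst.
case: eqP => _; last exact: cvg_cst.
by apply: cvgN; apply: cvgM => //; apply: cvgV.
Qed.

Let near_radius : \forall p \near Fil, 0 < p.1.
Proof.
have c1 : (fun p => p.1) @ Fil --> (0 : R)^'+ by exact: cvg_fst.
exact: (c1 _ (nbhs_right_gt (0 : R))).
Qed.

Let near_boundary : \forall p \near Fil, boundary F p.2.
Proof.
have c2 : (fun p => p.2) @ Fil --> within (boundary F) (nbhs xi) by exact: cvg_snd.
by apply: c2; exact: (withinT _ (nbhs_filter xi)).
Qed.

Let near_sub (P Q : set (R * 'rV[R]_n)) : (\forall p \near Fil, P p) ->
  (forall p, P p -> Q p) -> \forall p \near Fil, Q p.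
Proof. by move=> nP PQ; exact: (@filterS _ Fil Fil_filter P Q PQ nP). Qed.

Let near_and (P Q : set (R * 'rV[R]_n)) : (\forall p \near Fil, P p) ->
  (\forall p \near Fil, Q p) -> \forall p \near Fil, P p /\ Q p.
Proof. exact: filterI. Qed.

Let near_base (P : set 'rV[R]_n) : (\forall y \near xi, P y) ->
  \forall p \near Fil, P p.2.
Proof. by move=> nP; apply: cvg_base. Qed.

Let near_gt (phi : R * 'rV[R]_n -> R) l c :
  phi @ Fil --> l -> c < l -> \forall p \near Fil, c < phi p.
Proof. by move=> cphi cl; exact: (cvgr_gt _ cphi _ cl). Qed.

Let near_lt (phi : R * 'rV[R]_n -> R) l c :
  phi @ Fil --> l -> l < c -> \forall p \near Fil, phi p < c.
Proof. by move=> cphi cl; exact: (cvgr_lt _ cphi _ cl). Qed.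

Let cvg_qform (v : R * 'rV[R]_n -> 'rV[R]_n) w :
  v @ Fil --> w -> (fun p => qform H (v p)) @ Fil --> qform H w.
Proof. by move=> cv; exact: (cvg_dotp (cvg_mulmx_row cv) cv). Qed.

Let cvg_qmix :
  (fun p => qmix f xi (N p.2) (u p.2)) @ Fil --> qmix f xi (N xi) (u xi).
Proof.
exact: (cvgD (cvg_dotp (cvg_mulmx_row cvg_normal) cvg_udir)
  (cvg_dotp (cvg_mulmx_row cvg_udir) cvg_normal)).
Qed.

Let NN : 0 < dotp (N xi) (N xi).
Proof. exact: dotp_grad_gt0 fi. Qed.

Let uu : 0 < dotp (u xi) (u xi).
Proof. exact: dotp_udir_gt0. Qed.

Let cvg_nn := cvg_dotp cvg_normal cvg_normal.
Let cvg_uu := cvg_dotp cvg_udir cvg_udir.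
Let cvg_g := cvg_dotp cvg_base cvg_normal.
Let cvg_qu := cvg_qform cvg_udir.
Let cvg_qn := cvg_qform cvg_normal.

Let cvg_ratio : (fun p => qform H (u p.2) / dotp (u p.2) (u p.2)) @ Fil
  --> qform H (u xi) / dotp (u xi) (u xi).
Proof. exact: (cvgM cvg_qu (cvgV (lt0r_neq0 uu) cvg_uu)). Qed.


Let cvg_section_bound :
  (fun p => section_bound f xi i j p.2) @ Fil --> section_bound f xi i j xi.
Proof.
have sn0 : enorm (N xi) != 0 by rewrite lt0r_neq0 // enorm_gt0.
have su0 : enorm (u xi) != 0 by rewrite lt0r_neq0 // enorm_gt0.
have csn : (fun p => enorm (N p.2)) @ Fil --> enorm (N xi).
  exact: (cvg_enorm cvg_normal).
have csu : (fun p => enorm (u p.2)) @ Fil --> enorm (u xi).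
  exact: (cvg_enorm cvg_udir).
have sn2 : enorm (N xi) * enorm (N xi) != 0 by rewrite mulf_neq0.
have su2 : enorm (u xi) * enorm (u xi) != 0 by rewrite mulf_neq0.
have sn2' : 2 * (enorm (N xi) * enorm (N xi)) != 0 by rewrite mulf_neq0.
apply: cvgM; last first.
  apply: (cvgV sn2'); apply: cvgM; [exact: cvg_cst|exact: (cvgM csn csn)].
apply: cvgD; last first.
  apply: cvgM; [exact: (cvg_norm cvg_qmix)|exact: (cvgV su0 csu)].
apply: cvgM; last exact: (cvgV sn0 csn).
apply: cvgD; last exact: (cvg_norm cvg_qn).
apply: cvg_norm; apply: cvgM; last exact: (cvgV su2 (cvgM csu csu)).
exact: (cvgM (cvgM csn csn) cvg_qu).
Qed.

(** The coefficient of [r^2] in the depth of the osculating parabola of the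
    section at [xi], and the limit of [Chat / r^2]. *)
Definition kappa : R :=
  qform H (u xi) / dotp (u xi) (u xi) / 2 / dotp xi (N xi).

Let dotp_star eta y : dotp (eta - y) (star f eta)
  = dotp (eta - y) (N eta) / dotp eta (N eta).
Proof. by rewrite dotpZr mulrC. Qed.

Let near_good : \forall p \near Fil, [/\ boundary F p.2, U p.2,
  partial i f p.2 != 0, 0 < dotp p.2 (N p.2) & 0 < p.1].
Proof.
have nU : \forall p \near Fil, U p.2.
  by apply: near_base; exact: (open_nbhs_nbhs (conj oU Uxi)).
have ng : \forall p \near Fil, 0 < dotp p.2 (N p.2) := near_gt cvg_g gxi.
have cfi : (fun p => `|N p.2 0 i|) @ Fil --> `|N xi 0 i|.
  exact: (cvg_norm (cvg_coord cvg_normal)).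
have fi0 : 0 < `|N xi 0 i| by rewrite gradE normr_gt0.
have nfi : \forall p \near Fil, 0 < `|N p.2 0 i| := near_gt cfi fi0.
have all5 := near_and (near_and near_boundary nU)
  (near_and nfi (near_and ng near_radius)).
apply: (near_sub all5) => p [[? ?] [pi [? ?]]]; split=> //.
by rewrite -normr_gt0 -gradE.
Qed.

Lemma near_Chat_ge0 :
  \forall p \near Fil, (0 <= Chat F f p.1 p.2 (u p.2))%E.
Proof.
apply: (near_sub near_good) => -[r eta] /= [Beta Ueta fie geta r0].
apply: le_ereal_inf_tmp => _ [y [[Fy _] _] <-].
rewrite lee_fin dotp_star divr_ge0 ?(ltW geta) //.
have := grad_support Fconvex oU fC2 Ff (boundary_mem Fclosed Beta) Ueta
  ((bF Ueta).1 Beta) Fy.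
by rewrite -opprB dotpNl oppr_le0.
Qed.

(** [e] is chosen so that the bound of [depth_lower_bound], which tends to
    [kappa - e / (2 <xi, N>)], has its limit midway between [c] and [kappa]. *)
Lemma near_Chat_ge c : c < kappa ->
  \forall p \near Fil, ((c * p.1 ^+ 2)%:E <= Chat F f p.1 p.2 (u p.2))%E.
Proof.
move=> cK.
pose e := dotp xi (N xi) * (kappa - c).
have e0 : 0 < e by rewrite mulr_gt0 ?subr_gt0.
have e20 : 0 < e / 2 by rewrite divr_gt0.
have [rho rho0 taylor] := taylor2_uniform oU fC2 Uxi e20.
pose B p := 1 + p.1 * section_bound f xi i j p.2.
have cB : B @ Fil --> 1 + 0 * section_bound f xi i j xi.
  exact: (cvgD (cvg_cst (1 : R)) (cvgM cvg_radius cvg_section_bound)).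
pose L p := (qform H (u p.2) / dotp (u p.2) (u p.2) - e) / 2
  / (B p * dotp p.2 (N p.2)).
have cL : L @ Fil --> (qform H (u xi) / dotp (u xi) (u xi) - e) / 2
    / ((1 + 0 * section_bound f xi i j xi) * dotp xi (N xi)).
  have B0 : (1 + 0 * section_bound f xi i j xi) * dotp xi (N xi) != 0.
    by rewrite mul0r addr0 mul1r lt0r_neq0.
  apply: cvgM; last exact: (cvgV B0 (cvgM cB cvg_g)).
  apply: cvgM; last exact: cvg_cst.
  by apply: cvgB; [exact: cvg_ratio|exact: cvg_cst].
have nL : \forall p \near Fil, c < L p.
  apply: (near_gt cL).
  rewrite mul0r addr0 mul1r [ltRHS](_ : _ = kappa - (kappa - c) / 2); first lra.
  by rewrite /e /kappa; field; rewrite !lt0r_neq0.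
have nB : \forall p \near Fil, 0 < B p.
  by apply: (near_gt cB); rewrite mul0r addr0.
have nrho : \forall p \near Fil, `|xi - p.2| + p.1 < rho.
  have cr : (fun p => `|xi - p.2| + p.1) @ Fil --> `|xi - xi| + 0.
    apply: cvgD; last exact: cvg_radius.
    by apply: cvg_norm; apply: cvgB; [exact: cvg_cst|exact: cvg_base].
  by apply: (near_lt cr); rewrite subrr normr0 addr0.
apply: (near_sub (near_and near_good (near_and nL (near_and nB nrho)))) => -[r eta] /=.
move=> [[Beta Ueta fie geta r0] [Lc [Bp rhop]]].
apply: le_ereal_inf_tmp => _ [y [[Fy Py] ry] <-].
rewrite lee_fin dotp_star ler_pdivlMr //.
have D := depth_lower_bound Fclosed Fconvex oU fC2 Ff bF ij taylor Beta Ueta fie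
  r0 rhop Fy Py ry.
have := depth_div geta Bp D; rewrite -/(L (r, eta)).
apply: le_trans; rewrite ler_pM2r // ler_pM2r ?exprn_gt0 //; exact: ltW.
Qed.

(** The competitor [eta + h] has tangential component of length exactly [r], so
    it is far enough from [eta], and its depth exceeds that of the osculating
    parabola by a term [e r^2], which beats the Taylor remainder [e r^2 / 2] and
    makes [f (eta + h)] negative. *)
Lemma near_Chat_le c : kappa < c ->
  \forall p \near Fil, (Chat F f p.1 p.2 (u p.2) <= (c * p.1 ^+ 2)%:E)%E.
Proof.
move=> Kc.
pose e := dotp xi (N xi) * (c - kappa) / 2.
have e0 : 0 < e by rewrite divr_gt0 ?mulr_gt0 ?subr_gt0.
have e20 : 0 < e / 2 by rewrite divr_gt0.
have [rho rho0 taylor] := taylor2_uniform oU fC2 Uxi e20.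
pose D p := qform H (u p.2) / dotp (u p.2) (u p.2) / 2 + e.
pose al p := - (p.1 * (D p / dotp (N p.2) (N p.2))).
pose h p := (p.1 * al p) *: N p.2 + (p.1 / enorm (u p.2)) *: u p.2.
have su0 : enorm (u xi) != 0 by rewrite lt0r_neq0 // enorm_gt0.
have csu : (fun p => enorm (u p.2)) @ Fil --> enorm (u xi).
  exact: (cvg_enorm cvg_udir).
have cD : D @ Fil --> qform H (u xi) / dotp (u xi) (u xi) / 2 + e.
  apply: cvgD; last exact: cvg_cst.
  by apply: cvgM; [exact: cvg_ratio|exact: cvg_cst].
have cal : al @ Fil --> (0 : R).
  rewrite -[X in _ --> X]oppr0; apply: cvgN.
  rewrite -[X in _ --> X](mul0r ((qform H (u xi) / dotp (u xi) (u xi) / 2 + e)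
    / dotp (N xi) (N xi))).
  apply: cvgM; first exact: cvg_radius.
  by apply: cvgM; [exact: cD|exact: (cvgV (lt0r_neq0 NN) cvg_nn)].
have ch : h @ Fil --> (0 * 0 : R) *: N xi + (0 / enorm (u xi)) *: u xi.
  apply: cvgD.
    by apply: cvgZ; [exact: (cvgM cvg_radius cal)|exact: cvg_normal].
  by apply: cvgZ; [exact: (cvgM cvg_radius (cvgV su0 csu))|exact: cvg_udir].
have cy : (fun p => p.2 + h p) @ Fil --> xi.
  rewrite -[X in _ --> X]addr0; apply: cvgD; first exact: cvg_base.
  by move: ch; rewrite !mul0r !scale0r addr0.
(* [Phi] bounds [f (eta + h) / r^2] and tends to [- e / 2] *)
pose Phi p := - e + (al p ^+ 2 * qform H (N p.2)
    + al p / enorm (u p.2) * qmix f xi (N p.2) (u p.2)) / 2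
  + e / 2 * (al p ^+ 2 * dotp (N p.2) (N p.2) + 1).
have cal2 : (fun p => al p ^+ 2) @ Fil --> (0 : R) ^+ 2 by exact: (cvgM cal cal).
have cPhi : Phi @ Fil --> - e + ((0 : R) ^+ 2 * qform H (N xi)
    + 0 / enorm (u xi) * qmix f xi (N xi) (u xi)) / 2
  + e / 2 * ((0 : R) ^+ 2 * dotp (N xi) (N xi) + 1).
  apply: cvgD.
    apply: cvgD; first exact: cvg_cst.
    apply: cvgM; last exact: cvg_cst.
    apply: cvgD; first exact: (cvgM cal2 cvg_qn).
    exact: (cvgM (cvgM cal (cvgV su0 csu)) cvg_qmix).
  apply: cvgM; first exact: cvg_cst.
  by apply: cvgD; [exact: (cvgM cal2 cvg_nn)|exact: cvg_cst].
have nPhi : \forall p \near Fil, Phi p < 0.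
  apply: (near_lt cPhi); rewrite expr0n /= !mul0r !addr0 !add0r mul0r mulr1.
  by rewrite addr0; lra.
have nsub : \forall p \near Fil, f (p.2 + h p) < 0 -> F (p.2 + h p).
  exact: (cy _ (near_sublevel_mem Fclosed Fconvex F0 oU fC2 bF
    (boundary_mem Fclosed bxi) Uxi gxi)).
have nD : \forall p \near Fil, D p / dotp p.2 (N p.2) < c.
  have cDg : (fun p => D p / dotp p.2 (N p.2)) @ Fil -->
      (qform H (u xi) / dotp (u xi) (u xi) / 2 + e) / dotp xi (N xi).
    exact: (cvgM cD (cvgV (lt0r_neq0 gxi) cvg_g)).
  apply: (near_lt cDg).
  rewrite [ltLHS](_ : _ = kappa + (c - kappa) / 2); first lra.
  by rewrite /e /kappa; field; rewrite !lt0r_neq0.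
have nrho1 : \forall p \near Fil, `|xi - p.2| < rho.
  have cr : (fun p => `|xi - p.2|) @ Fil --> `|xi - xi|.
    by apply: cvg_norm; apply: cvgB; [exact: cvg_cst|exact: cvg_base].
  by apply: (near_lt cr); rewrite subrr normr0.
have nrho2 : \forall p \near Fil, `|xi - (p.2 + h p)| < rho.
  have cr : (fun p => `|xi - (p.2 + h p)|) @ Fil --> `|xi - xi|.
    by apply: cvg_norm; apply: cvgB; [exact: cvg_cst|exact: cy].
  by apply: (near_lt cr); rewrite subrr normr0.
apply: (near_sub (near_and near_good (near_and (near_and nPhi nsub)
  (near_and nD (near_and nrho1 nrho2))))) => -[r eta] /=.
move=> [[Beta Ueta fie geta r0] [[Phi0 hF] [Dc [rho1 rho2]]]].
have nn0 : 0 < dotp (N eta) (N eta) by exact: dotp_grad_gt0 fie.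
have su_gt0 : 0 < enorm (u eta) by rewrite enorm_gt0; exact: dotp_udir_gt0.
have uN : dotp (u eta) (N eta) = 0 by exact: dotp_udir.
have hN : dotp (h (r, eta)) (N eta) = - (r ^+ 2 * D (r, eta)).
  rewrite /h dotpDl !dotpZl uN mulr0 addr0 /al /=.
  move: (D (r, eta)) => d; field; exact: lt0r_neq0.
have hh : dotp (h (r, eta)) (h (r, eta))
    = r ^+ 2 * (al (r, eta) ^+ 2 * dotp (N eta) (N eta) + 1).
  rewrite /h !dotpDl !dotpDr !dotpZl !dotpZr (dotpC (N eta) (u eta)) uN.
  rewrite -(sqr_enorm (u eta)) /=; move: (al (r, eta)) => a.
  by field; exact: lt0r_neq0.
have fy : f (eta + h (r, eta)) < 0.
  have := taylor eta (h (r, eta)) rho1 rho2.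
  rewrite ((bF Ueta).1 Beta) add0r ler_norml => /andP[_ T].
  move: T; rewrite lerBlDl => T; apply: (le_lt_trans T).
  suff -> : dotp (h (r, eta)) (N eta) + qform H (h (r, eta)) / 2
      + e / 2 * dotp (h (r, eta)) (h (r, eta)) = r ^+ 2 * Phi (r, eta).
    by rewrite pmulr_rlt0 ?exprn_gt0.
  rewrite hN hh /h qform_comb /Phi /D -(sqr_enorm (u eta)) /=.
  move: (al (r, eta)) => a.
  by field; exact: lt0r_neq0.
apply: ge_ereal_inf; exists (dotp (eta - (eta + h (r, eta))) (star f eta))%:E.
  exists (eta + h (r, eta)) => //; split; first split.
  - exact: hF.
  - apply/planeP; exists (r * al (r, eta)), (r / enorm (u eta)).
    by rewrite addrAC subrr add0r.
  - rewrite /= opprD addrA subrr add0r enormN.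
    rewrite -[leLHS]ger0_norm ?(ltW r0) // -sqrtr_sqr ler_wsqrtr // hh.
    rewrite ler_peMr ?sqr_ge0 // lerDr mulr_ge0 ?sqr_ge0 //; exact: ltW.
rewrite lee_fin dotp_star opprD addrA subrr add0r dotpNl hN opprK.
rewrite -mulrA mulrC ler_pM2r ?exprn_gt0 //; exact: ltW.
Qed.

Lemma dir_curvatureE : dir_curvature F f i j xi
  = ((enorm (star f xi))^-1 * kappa)%:E.
Proof.
rewrite /dir_curvature EFinM; congr (_ * _)%E.
apply: (@limf_einf_fin _ _ _ _ _ _ Fil_proper) => c Kc.
  apply: (near_sub (near_and near_radius (near_Chat_ge Kc))) => p [r0 lo].
  have r20 : 0 < p.1 ^- 2 by rewrite invr_gt0 exprn_gt0.
  rewrite -[c](mulfK (lt0r_neq0 (exprn_gt0 2 r0))) EFinM.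
  by apply: lee_wpmul2r => //; rewrite lee_fin ltW.
apply: (near_sub (near_and near_radius (near_Chat_le Kc))) => p [r0 up].
have r20 : 0 < p.1 ^- 2 by rewrite invr_gt0 exprn_gt0.
rewrite -[c](mulfK (lt0r_neq0 (exprn_gt0 2 r0))) EFinM.
by apply: lee_wpmul2r => //; rewrite lee_fin ltW.
Qed.

Lemma kappa_ge0 : 0 <= kappa.
Proof.
rewrite leNgt; apply/negP => K0.
(* a negative [kappa] would leave room for a negative upper bound of [Chat] *)
have K2 : kappa < kappa / 2 by lra.
have [p [[r0 lo] up]] :=
  @filter_ex _ _ Fil_proper _
    (near_and (near_and near_radius near_Chat_ge0) (near_Chat_le K2)).
have := le_trans lo up; rewrite lee_fin pmulr_lge0 ?exprn_gt0 //; lra.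
Qed.

End DirectionalLimit.

(** * The two curvatures agree *)

Theorem corollary5 (R : realType) (n : nat) (hn : (3 <= n)%N)
  (F : set 'rV[R]_n) (Fcompact : compact F) (Fconvex : convex_set F)
  (F0 : interior F 0)
  (xi : 'rV[R]_n) (xiF : boundary F xi)
  (delta : R) (delta_gt0 : 0 < delta)
  (f : 'rV[R]_n -> R) (fC2 : class_C 2 f (eball xi delta))
  (Ff : F `<=` [set x | f x <= 0])
  (xi_grad : 0 < dotp xi (grad f xi))
  (Ff0 : forall x, eball xi delta x -> (boundary F x <-> f x = 0))
  (i : 'I_n) (fi : partial i f xi != 0)
  (i_first : forall k : 'I_n, (k < i)%N -> partial k f xi = 0)
  (j : 'I_n) (ji : j != i) :
  (goldman_curvature (curve_eqs f i j xi) xi)%:E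
    = (2%:E * dir_curvature F f i j xi)%E.
Proof.
pose U := eball xi delta.
have Uxi : U xi.
  rewrite /U /eball /= subrr /enorm /dotp big1 ?sqrtr0 // => k _.
  by rewrite mxE mul0r.
have oU : open U := @open_eball R n xi delta.
have Fclosed : closed F by apply: compact_closed Fcompact; exact: norm_hausdorff.
have ij : i != j by rewrite eq_sym.
have curvE := goldman_curvatureE oU fC2 Uxi ij fi; rewrite /= in curvE.
have dirE := dir_curvatureE Fclosed Fconvex F0 oU fC2 Ff Ff0 Uxi xiF xi_grad ij fi.
have K0 := kappa_ge0 Fclosed Fconvex F0 oU fC2 Ff Ff0 Uxi xiF xi_grad ij fi.
rewrite curvE dirE -EFinM; congr (_%:E); move: K0; rewrite /kappa.
have uu0 := dotp_udir_gt0 f i j xi; have NN0 := dotp_grad_gt0 fi.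
have sN0 : 0 < enorm (grad f xi) by rewrite enorm_gt0.
have g_inv : 0 < (dotp xi (grad f xi))^-1 by rewrite invr_gt0.
rewrite /star enormZ (gtr0_norm g_inv).
move: (qform _ _) (dotp (udir f i j xi) _) (dotp xi _) uu0 xi_grad sN0 => q d g d0 g0.
move: (enorm _) => s s0 K0; have q0 : 0 <= q.
  by move: K0; rewrite !pmulr_lge0 ?invr_gt0.
by rewrite ger0_norm //; field; rewrite !lt0r_neq0.
Qed.
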